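(* Let $\Lambda$ be an artin algebra and let $\mathcal{C}$ be a functorially finite (full, additive) subcategory of $\mathrm{mod}\,\Lambda$, closed under direct summands and isomorphisms. (a) If $\mathcal{C}$ contains $D\Lambda$, then the following are equivalent. (i) There exists $t\in\mathbb{N}$ such that for any $X\in\mathrm{ind}\,\mathcal{C}$, $\mathrm{rad}^t_{\mathcal{C}}(X,-)=0$. (ii) For any $X\in\mathrm{ind}\,\mathcal{C}$, there exists $t\in\mathbb{N}$ such that $\mathrm{rad}^t_{\mathcal{C}}(X,-)=0$. (iii) $\mathcal{C}$ is of finite representation type. (iv) $\mathrm{rad}^\infty_{\mathcal{C}}=0$. (b) If $\mathcal{C}$ contains $\Lambda$, then the following are equivalent. (i) There exists $t\in\mathbb{N}$ such that for any $X\in\mathrm{ind}\,\mathcal{C}$, $\mathrm{rad}^t_{\mathcal{C}}(-,X)=0$. (ii) For any $X\in\mathrm{ind}\,\mathcal{C}$, there exists $t\in\mathbb{N}$ such that $\mathrm{rad}^t_{\mathcal{C}}(-,X)=0$. (iii) $\mathcal{C}$ is of finite representation type. (iv) $\mathrm{rad}^\infty_{\mathcal{C}}=0$.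
   Context: $\Lambda$ is an artin $R$-algebra over a commutative artinian ring $R$; $\mathrm{mod}\,\Lambda$ is the category of finitely generated left $\Lambda$-modules; $D=\mathrm{Hom}_R(-,I)$ with $I$ the injective envelope of $R/J_R$, $J_R$ the Jacobson radical of $R$. A left $\mathcal{C}$-approximation of $X\in\mathrm{mod}\,\Lambda$ is a morphism $\alpha:X\to C$ with $C\in\mathcal{C}$ such that every morphism $X\to C'$ with $C'\in\mathcal{C}$ factors through $\alpha$; right $\mathcal{C}$-approximations are dual. $\mathcal{C}$ is functorially finite if every $X\in\mathrm{mod}\,\Lambda$ has both a left and a right $\mathcal{C}$-approximation. $\mathrm{ind}\,\mathcal{C}$ is the full subcategory of indecomposable objects of $\mathcal{C}$; $\mathcal{C}$ is of finite representation type if it has finitely many isomorphism classes of indecomposable objects. $\mathrm{rad}_{\mathcal{C}}(X,Y)=\{h\in\mathrm{Hom}_{\mathcal{C}}(X,Y) : 1_X-gh \text{ is invertible for all } g\in\mathrm{Hom}_{\mathcal{C}}(Y,X)\}$. For $i\ge 1$, $\mathrm{rad}^i_{\mathcal{C}}(X,Y)$ consists of all finite sums of compositions $X=X_0\xrightarrow{h_1}X_1\to\cdots\xrightarrow{h_i}X_i=Y$ with all $X_j\in\mathcal{C}$ and $h_j\in\mathrm{rad}_{\mathcal{C}}(X_{j-1},X_j)$. $\mathrm{rad}^\infty_{\mathcal{C}}=\bigcap_{i\ge1}\mathrm{rad}^i_{\mathcal{C}}$. $\mathrm{rad}^t_{\mathcal{C}}(X,-)=0$ means $\mathrm{rad}^t_{\mathcal{C}}(X,Y)=0$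 for all $Y\in\mathcal{C}$, and similarly for $\mathrm{rad}^t_{\mathcal{C}}(-,X)=0$; $\mathrm{rad}^\infty_{\mathcal{C}}=0$ means $\mathrm{rad}^\infty_{\mathcal{C}}(X,Y)=0$ for all $X,Y\in\mathcal{C}$. *)

(* Defs.v *)
From HB Require Import structures.
From mathcomp Require Import all_boot all_algebra.
From mathcomp Require Import boolp.

Set Implicit Arguments.
Unset Strict Implicit.
Unset Printing Implicit Defensive.

Import GRing.Theory.
Local Open Scope ring_scope.
Local Open Scope quotient_scope.

(* By the classical axioms of boolp every type carries eqType and choiceType
   structures and every subset is a {pred _}; hence lmodType A ranges over all
   left A-modules and {pred V} over all subsets of V. *)

Section Modules.
Variable A : pzRingType.
Implicit Types M X Y Z : lmodType A.

Definition fin_gen M : Prop :=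
  exists (n : nat) (g : 'I_n -> M),
    forall x : M, exists c : 'I_n -> A, x = \sum_(i < n) c i *: g i.

Definition isomorphism X Y (f : {linear X -> Y}) : Prop :=
  exists g : {linear Y -> X}, cancel f g /\ cancel g f.

Definition isomorphic X Y : Prop :=
  exists f : {linear X -> Y}, isomorphism f.

Definition is_zero M : Prop := forall x : M, x = 0.

Definition indecomposable M : Prop :=
  ~ is_zero M /\
  forall X Y, isomorphic M (X * Y)%type -> is_zero X \/ is_zero Y.

Definition injective_module M : Prop :=
  forall X Y (f : {linear X -> Y}) (g : {linear X -> M}),
    injective f -> exists h : {linear Y -> M}, h \o f =1 g.

Definition essential_mono M X (e : {linear M -> X}) : Prop :=
  injective e /\
  forall S : {pred X}, submod_closed S ->
    (exists2 x, x \in S & x != 0) -> exists2 m, e m \in S & e m != 0.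

Definition injective_envelope M X (e : {linear M -> X}) : Prop :=
  injective_module X /\ essential_mono e.

End Modules.

Section ArtinAlgebra.
Variable R : comNzRingType.

Definition artinian : Prop :=
  forall I : nat -> {pred R^o},
    (forall n, submod_closed (I n)) ->
    (forall n, {subset I n.+1 <= I n}) ->
    exists n, forall m, (n <= m)%N -> I m =i I n.

(* idealr_closed is the library's notion of a proper ideal. *)
Definition maximal_ideal (m : {pred R}) : Prop :=
  idealr_closed m /\
  forall n : {pred R}, idealr_closed n -> {subset m <= n} -> {subset n <= m}.

Definition jacobson : R^o -> bool :=
  fun x => `[< forall m : {pred R}, maximal_ideal m -> x \in m >].

Lemma jacobson_submod : submod_closed (jacobson : {pred R^o}).
Proof.
split=> [|a u v /asboolP ju /asboolP jv]; apply/asboolP => m mm.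
  by case: mm => -[].
by have [[_ _ mS] _] := mm; apply: mS; [exact: ju | exact: jv].
Qed.

HB.instance Definition _ :=
  GRing.isZmodClosed.Build R^o jacobson (GRing.submod_closedB jacobson_submod).

Definition jacobson_zmod := GRing.ZmodClosed.clone R^o jacobson _.

(* The R-module R/J_R. *)
Definition residue_ring : Type := Quotient.quot jacobson_zmod.

HB.instance Definition _ :=
  GRing.Zmodule.copy residue_ring (Quotient.quot jacobson_zmod).

Definition residue_scale (a : R) (x : residue_ring) : residue_ring :=
  \pi_(Quotient.quot jacobson_zmod) (a *: repr x).

Lemma residue_scaleE a (x : R^o) :
  residue_scale a (\pi_(Quotient.quot jacobson_zmod) x) =
  \pi_(Quotient.quot jacobson_zmod) (a *: x).
Proof.
apply/eqP; rewrite /residue_scale -Quotient.idealrBE -scalerBr.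
have J : repr (\pi_(Quotient.quot jacobson_zmod) x) - x \in jacobson.
  by rewrite Quotient.idealrBE reprK.
by case: jacobson_submod => J0 /(_ a _ 0 J J0); rewrite addr0.
Qed.

Lemma residue_scaleA a b v :
  residue_scale a (residue_scale b v) = residue_scale (a * b) v.
Proof.
by rewrite -[v]reprK !residue_scaleE scalerA reprK.
Qed.

Lemma residue_scale1 : left_id 1 residue_scale.
Proof. by move=> v; rewrite -[v]reprK residue_scaleE scale1r. Qed.

Lemma residue_scaleDr : right_distributive residue_scale +%R.
Proof.
move=> a u v; rewrite -[u]reprK -[v]reprK.
by rewrite -raddfD !residue_scaleE scalerDr raddfD.
Qed.

Lemma residue_scaleDl v : {morph residue_scale^~ v : a b / a + b}.
Proof.
by move=> a b; rewrite -[v]reprK !residue_scaleE scalerDl raddfD.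
Qed.

HB.instance Definition _ := GRing.Zmodule_isLmodule.Build R residue_ring
  residue_scaleA residue_scale1 residue_scaleDr residue_scaleDl.

Definition artin_algebra (L : algType R) : Prop := artinian /\ fin_gen L.

End ArtinAlgebra.

Section Dual.
Variables (R : comNzRingType) (L : algType R) (I : lmodType R).

(* Hom_R(L, I) for L seen as a right module over itself; it is a left L-module
   by (a f)(x) = f (x a). *)
Definition dual : Type := {linear L -> I}.

HB.instance Definition _ := gen_eqMixin dual.
HB.instance Definition _ := gen_choiceMixin dual.

Definition dual_fun (f : dual) : L -> I := (f : {linear L -> I}).

Lemma dual_ext (f g : dual) : dual_fun f =1 dual_fun g -> f = g.
Proof.
case: f g => [f [[[f1 f2]] [f3]]] [g [[[g1 g2]] [g3]]] /funext /= fg.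
have {}fg : f = g by exact: fg.
case: _ / fg g1 g2 g3 => g1 g2 g3.
by rewrite (Prop_irrelevance f1 g1) (Prop_irrelevance f2 g2)
  (Prop_irrelevance f3 g3).
Qed.

Section Operations.
Implicit Types f g : {linear L -> I}.

Definition dual_zero : dual := (\0 : {linear L -> I}).
Definition dual_opp f : dual := (\- f : {linear L -> I}).
Definition dual_add f g : dual := (f \+ g : {linear L -> I}).

Lemma dual_addA : associative (dual_add : dual -> dual -> dual).
Proof. by move=> f g h; apply: dual_ext => x; exact: addrA. Qed.

Lemma dual_addC : commutative (dual_add : dual -> dual -> dual).
Proof. by move=> f g; apply: dual_ext => x; exact: addrC. Qed.

Lemma dual_add0 : left_id dual_zero (dual_add : dual -> dual -> dual).
Proof. by move=> f; apply: dual_ext => x; exact: add0r. Qed.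

Lemma dual_addN :
  left_inverse dual_zero (dual_opp : dual -> dual)
    (dual_add : dual -> dual -> dual).
Proof. by move=> f; apply: dual_ext => x; exact: addNr. Qed.

End Operations.

HB.instance Definition _ :=
  GRing.isZmodule.Build dual dual_addA dual_addC dual_add0 dual_addN.

Definition dual_act (a : L) (f : dual) (x : L) : I := dual_fun f (x * a).

Lemma dual_act_linear a f : linear (dual_act a f).
Proof.
by move=> r x y; rewrite /dual_act mulrDl -scalerAl /dual_fun linearP.
Qed.

HB.instance Definition _ a f :=
  GRing.isLinear.Build R L I *:%R (dual_act a f) (dual_act_linear a f).

Definition dual_scale (a : L) (f : dual) : dual :=
  (dual_act a f : {linear L -> I}).

Lemma dual_scaleA a b f : dual_scale a (dual_scale b f) = dual_scale (a * b) f.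
Proof.
by apply: dual_ext => x; rewrite /dual_fun /= /dual_act /dual_fun /= /dual_act mulrA.
Qed.

Lemma dual_scale1 : left_id 1 dual_scale.
Proof. by move=> f; apply: dual_ext => x; rewrite /dual_fun /= /dual_act mulr1. Qed.

Lemma dual_scaleDr : right_distributive dual_scale +%R.
Proof. by move=> a f g; apply: dual_ext => x. Qed.

Lemma dual_scaleDl f : {morph dual_scale^~ f : a b / a + b}.
Proof.
move=> a b; apply: dual_ext => x.
by rewrite /dual_fun /= /dual_act mulrDr /dual_fun raddfD.
Qed.

HB.instance Definition _ := GRing.Zmodule_isLmodule.Build L dual
  dual_scaleA dual_scale1 dual_scaleDr dual_scaleDl.

End Dual.

Section Subcategories.
Variables (A : pzRingType) (C : lmodType A -> Prop).
Implicit Types X Y Z : lmodType A.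

Definition subcategory_of_mod : Prop := forall X, C X -> fin_gen X.

Definition closed_iso : Prop := forall X Y, isomorphic X Y -> C X -> C Y.

Definition additive_subcategory : Prop :=
  (forall X, is_zero X -> C X) /\
  (forall X Y, C X -> C Y -> C (X * Y)%type).

Definition closed_summands : Prop :=
  forall X Y Z, isomorphic Z (X * Y)%type -> C Z -> C X.

Definition left_approximation X Y (f : {linear X -> Y}) : Prop :=
  C Y /\
  forall Z (g : {linear X -> Z}), C Z -> exists h : {linear Y -> Z}, g =1 h \o f.

Definition right_approximation X Y (f : {linear Y -> X}) : Prop :=
  C Y /\
  forall Z (g : {linear Z -> X}), C Z -> exists h : {linear Z -> Y}, g =1 f \o h.

Definition functorially_finite : Prop :=
  forall X, fin_gen X ->
    (exists Y (f : {linear X -> Y}), left_approximation f) /\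
    (exists Y (f : {linear Y -> X}), right_approximation f).

Definition ind X : Prop := C X /\ indecomposable X.

Definition finite_rep_type : Prop :=
  exists (n : nat) (F : 'I_n -> lmodType A),
    (forall i, ind (F i)) /\ forall X, ind X -> exists i, isomorphic X (F i).

(* C is a full subcategory, so the radical does not depend on it beyond the
   membership of its two arguments. *)
Definition rad X Y (h : {linear X -> Y}) : Prop :=
  forall g : {linear Y -> X},
    isomorphism ((idfun : {linear X -> X}) \- (g \o h) : {linear X -> X}).

(* Compositions of i radical morphisms through objects of C; for i = 0 all
   morphisms are allowed, so that the zeroth power of the radical is Hom. *)
Fixpoint rad_composite (i : nat) X Y (f : {linear X -> Y}) : Prop :=
  match i with
  | 0 => True
  | 1 => rad f
  | i'.+1 => exists Z (h : {linear X -> Z}) (k : {linear Z -> Y}),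
      [/\ C Z, rad h, rad_composite i' k & f =1 k \o h]
  end.

Definition rad_pow (i : nat) X Y (f : {linear X -> Y}) : Prop :=
  exists (n : nat) (g : 'I_n -> {linear X -> Y}),
    (forall j, rad_composite i (g j)) /\ forall x, f x = \sum_(j < n) g j x.

Definition rad_infty X Y (f : {linear X -> Y}) : Prop :=
  forall i, (1 <= i)%N -> rad_pow i f.

Definition rad_pow_from_zero (t : nat) X : Prop :=
  forall Y (f : {linear X -> Y}), C Y -> rad_pow t f -> f =1 \0.

Definition rad_pow_to_zero (t : nat) X : Prop :=
  forall Y (f : {linear Y -> X}), C Y -> rad_pow t f -> f =1 \0.

Definition rad_infty_zero : Prop :=
  forall X Y (f : {linear X -> Y}), C X -> C Y -> rad_infty f -> f =1 \0.

End Subcategories.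

(* Main.v *)
(** (ii) => (iii): C has right and left almost split morphisms, obtained by
    approximating those of mod L. In (b), every indecomposable Y of C maps
    nontrivially to a right C-approximation W of an injective cogenerator; if
    rad^t(-, W) = 0 then Y is reached from W in fewer than t steps along right
    almost split morphisms, which leaves finitely many Y. In (a), use left almost
    split morphisms and a left approximation of L.
    (iii) => (i), (iv): if M is the sum of the indecomposables of C, the powers
    of the radical of End(M) stabilise at some B = BB, and Nakayama's argument
    gives B = 0.
    (iv) => (ii): rad^i(X, D L), resp. rad^i(L, X), is a descending chain of
    R-submodules of a module of finite length, hence vanishes for some i, and a
    map X -> Y is detected after composing with Y -> D L, resp. L -> X.
    Almost split morphisms in mod L come from the presentation of the functor
    D Hom(X, -) by duality. In (b) no injective R-module is given; one of finite
    length is found as an essential extension of R / m of maximal length. *)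
From HB Require Import structures.
From mathcomp Require Import all_boot all_algebra.
From mathcomp Require Import boolp.
Require Import Defs.

Set Implicit Arguments.
Unset Strict Implicit.
Unset Printing Implicit Defensive.

Import GRing.Theory.
Local Open Scope ring_scope.
Local Open Scope quotient_scope.

(** * Submodules and length *)

Section LinearMaps.
Variable A : pzRingType.
Implicit Types X Y Z : lmodType A.

(** Length is handled without composition series: [flen] only bounds strict chains of submodules,
    and extremal submodules replace inductions on length. Hom-sets are not treated as modules; a set
    of maps is studied through its values at one element or at generators, which form R-submodules
    of a module of finite length. D X likewise occurs only through functionals X -> I. The two
    halves are not symmetric. For right almost split maps it is enough that functionals separate
    points, so any injective cogenerator of finite length serves. For left almost split maps a map Y
    -> X must be recovered from its action on functionals, so X has to be its own double dual; this
    holds because each simple R-module occurs exactly once in the socle of the envelope of R / J_R.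
    Finite length is there a property of D L, as an object of C, and not of I. Radical maps X -> Y
    or Y -> X are characterised by linear equations over L because an indecomposable X has a
    non-zero element killed by all its non-isomorphisms: composing a radical map with any map back
    to X kills this element, and injectivity of I turns that vanishing into solvability of a linear
    system. *)

Lemma linear_eq X Y (f g : {linear X -> Y}) : f =1 g -> f = g.
Proof.
case: f g => [f [[[f1 f2]] [f3]]] [g [[[g1 g2]] [g3]]] /funext /= fg.
have {}fg : f = g by exact: fg.
case: _ / fg g1 g2 g3 => g1 g2 g3.
by rewrite (Prop_irrelevance f1 g1) (Prop_irrelevance f2 g2)
  (Prop_irrelevance f3 g3).
Qed.

Definition mklin X Y (f : X -> Y) (fP : linear f) : {linear X -> Y} :=
  HB.pack f (GRing.isLinear.Build A X Y *:%R f fP).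

Lemma mklinE X Y (f : X -> Y) (fP : linear f) x : mklin fP x = f x.
Proof. by []. Qed.

Lemma iso_of_bij X Y (f : {linear X -> Y}) :
  injective f -> (forall y, exists x, f x = y) -> isomorphism f.
Proof.
move=> fI /choice[g gK].
have gL : linear g.
  by move=> a x y; apply: fI; rewrite gK linearP !gK.
exists (mklin gL); split=> x; last exact: gK.
by apply: fI; exact: gK.
Qed.

Lemma iso_inj X Y (f : {linear X -> Y}) : isomorphism f -> injective f.
Proof. by case=> g [/can_inj]. Qed.

Lemma isomorphic_sym X Y : isomorphic X Y -> isomorphic Y X.
Proof. by move=> [f [g [fK gK]]]; exists g, f. Qed.

Lemma isomorphic_trans X Y Z :
  isomorphic X Y -> isomorphic Y Z -> isomorphic X Z.
Proof.
move=> [f [g [fK gK]]] [f' [g' [fK' gK']]].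
exists (f' \o f : {linear X -> Z}), (g \o g' : {linear Z -> X}).
by split=> x /=; rewrite (fK', gK) ?fK ?gK'.
Qed.

Lemma linear_for_sum X Y (f : {linear X -> Y}) n (g : 'I_n -> X) (c : 'I_n -> A) :
  f (\sum_i c i *: g i) = \sum_i c i *: f (g i).
Proof. by rewrite linear_sum; apply: eq_bigr => i _; rewrite linearZ. Qed.

End LinearMaps.

Section Submodules.
Variable A : pzRingType.

Definition submod (V : lmodType A) (S : V -> Prop) : Prop :=
  S 0 /\ forall a x y, S x -> S y -> S (a *: x + y).

Section Basics.
Variables (V : lmodType A) (S : V -> Prop).
Hypothesis SS : submod S.

Lemma submod0 : S 0. Proof. by case: SS. Qed.

Lemma submodZ a x : S x -> S (a *: x).
Proof. by case: SS => S0 SP Sx; rewrite -[_ *: _]addr0; apply: SP. Qed.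

Lemma submodD x y : S x -> S y -> S (x + y).
Proof. by case: SS => S0 SP Sx Sy; rewrite -[x]scale1r; apply: SP. Qed.

Lemma submodN x : S x -> S (- x).
Proof. by move=> Sx; rewrite -scaleN1r; apply: submodZ. Qed.

Lemma submodB x y : S x -> S y -> S (x - y).
Proof. by move=> Sx Sy; apply: submodD => //; apply: submodN. Qed.

Lemma submod_sum n (g : 'I_n -> V) : (forall i, S (g i)) -> S (\sum_i g i).
Proof. by move=> Sg; apply: big_ind => //; [exact: submod0|exact: submodD]. Qed.

End Basics.

Lemma submodT (V : lmodType A) : submod (fun _ : V => True).
Proof. by []. Qed.

Lemma submod_eq0 (V : lmodType A) : submod (fun x : V => x = 0).
Proof. by split=> // a x y -> ->; rewrite scaler0 addr0. Qed.

Lemma submod_ker (V W : lmodType A) (f : {linear V -> W}) :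
  submod (fun x => f x = 0).
Proof. by split=> [|a x y fx fy]; rewrite ?linear0// linearP fx fy scaler0 addr0. Qed.

Lemma submodI (V : lmodType A) (S T : V -> Prop) :
  submod S -> submod T -> submod (fun x => S x /\ T x).
Proof.
move=> [S0 SP] [T0 TP]; split=> // a x y [Sx Tx] [Sy Ty].
by split; [apply: SP|apply: TP].
Qed.

Lemma submod_add (V : lmodType A) (S T : V -> Prop) : submod S -> submod T ->
  submod (fun x => exists s t, [/\ S s, T t & x = s + t]).
Proof.
move=> SS ST; split.
  by exists 0, 0; rewrite addr0; split=> //; apply: submod0.
move=> a x y [s [t [Ss Tt ->]]] [s' [t' [Ss' Tt' ->]]].
exists (a *: s + s'), (a *: t + t'); split; last by rewrite scalerDr addrACA.
  by case: SS => _; apply.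
by case: ST => _; apply.
Qed.

Lemma submod_cyclic (V : lmodType A) (v : V) :
  submod (fun x => exists a, x = a *: v).
Proof.
split; first by exists 0; rewrite scale0r.
by move=> a _ _ [b ->] [c ->]; exists (a * b + c); rewrite scalerDl scalerA.
Qed.

Lemma submod_span (V : lmodType A) n (g : 'I_n -> V) :
  submod (fun x => exists c : 'I_n -> A, x = \sum_i c i *: g i).
Proof.
split.
  by exists (fun=> 0); rewrite big1// => i _; rewrite scale0r.
move=> a _ _ [b ->] [c ->]; exists (fun i => a * b i + c i).
rewrite scaler_sumr -big_split/=; apply: eq_bigr => i _.
by rewrite scalerDl scalerA.
Qed.

Lemma submod_image (V W : lmodType A) (f : {linear V -> W}) (S : V -> Prop) :
  submod S -> submod (fun y => exists2 x, S x & y = f x).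
Proof.
move=> SS; split; first by exists 0; [apply: submod0|rewrite linear0].
move=> a _ _ [x Sx ->] [y Sy ->]; exists (a *: x + y); last by rewrite linearP.
by case: SS => _; apply.
Qed.

Lemma submod_preim (V W : lmodType A) (f : {linear V -> W}) (S : W -> Prop) :
  submod S -> submod (fun x => S (f x)).
Proof.
move=> [S0 SP]; split; first by rewrite linear0.
by move=> a x y Sx Sy; rewrite linearP; apply: SP.
Qed.

(** A strictly descending chain with n steps starting at S, so [~ chain n S] says that S has length
    less than n. Only the lower terms are required to be submodules. *)
Fixpoint chain (V : lmodType A) (n : nat) (S : V -> Prop) : Prop :=
  if n is n'.+1 then
    exists T, [/\ submod T, forall x, T x -> S x, exists2 x, S x & ~ T x
                & chain n' T]
  else True.

Definition flen (V : lmodType A) (S : V -> Prop) := exists n, ~ chain n S.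

Definition flenT (V : lmodType A) := flen (fun _ : V => True).

Section Length.
Variable V : lmodType A.
Implicit Types S T : V -> Prop.

Lemma chain_sub n S T : (forall x, S x -> T x) -> chain n S -> chain n T.
Proof.
case: n => //= n ST [U [sU US [x Sx Ux] cU]]; exists U; split=> //.
- by move=> y /US/ST.
- by exists x => //; apply: ST.
Qed.

Lemma chain_le m n S : (m <= n)%N -> chain n S -> chain m S.
Proof.
elim: n m S => [|n IH] [|m] S //= le_mn [T [sT TS xT cT]].
by exists T; split=> //; apply: IH cT.
Qed.

Lemma flen_sub S T : (forall x, S x -> T x) -> flen T -> flen S.
Proof. by move=> ST [n nT]; exists n => /(chain_sub ST). Qed.

Lemma flen_all S : flenT V -> flen S.
Proof. exact: flen_sub. Qed.

(** If S is not minimal, a smaller U with P has strictly shorter chains than S; induct on the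
    bound. *)
Lemma flen_min (P : (V -> Prop) -> Prop) S : flen S -> submod S -> P S ->
  exists T, [/\ submod T, P T, forall x, T x -> S x &
    forall U, submod U -> P U -> (forall x, U x -> T x) -> forall x, T x -> U x].
Proof.
case=> n; elim: n S => [|n IH] S nS sS PS; first by case: nS.
have [minS|] := pselect (forall U, submod U -> P U ->
    (forall x, U x -> S x) -> forall x, S x -> U x).
  by exists S; split.
move=> /existsNP[U] /not_implyP[sU] /not_implyP[PU] /not_implyP[US].
move=> /existsNP[x] /not_implyP[Sx Ux].
have [||//|T [sT PT TU minT]] := IH U; last first.
- by exists T; split=> // y /TU /US.
- by [].
- by move=> cU; apply: nS => /=; exists U; split=> //; exists x.
Qed.

(** Without a maximal T one could climb forever from S, and each climb adds a step at the top of a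
    descending chain, contradicting the bound on V. *)
Lemma flen_max (P : (V -> Prop) -> Prop) S : flenT V -> submod S -> P S ->
  exists T, [/\ submod T, P T, forall x, S x -> T x &
    forall U, submod U -> P U -> (forall x, T x -> U x) -> forall x, U x -> T x].
Proof.
move=> [n nV] sS PS; apply: contrapT => nomax; apply: nV.
suff [T [sT PT ST cT]] : exists T, [/\ submod T, P T, forall x, S x -> T x & chain n T].
  exact: chain_sub cT.
elim: n => [|n [T [sT PT ST cT]]]; first by exists S.
have : ~ forall U, submod U -> P U -> (forall x, T x -> U x) -> forall x, U x -> T x.
  by move=> maxT; apply: nomax; exists T; split.
move=> /existsNP[U] /not_implyP[sU] /not_implyP[PU] /not_implyP[TU].
move=> /existsNP[x] /not_implyP[Ux Tx].
exists U; split=> //; first by move=> y /ST /TU.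
by exists T; split=> //; exists x.
Qed.

Lemma flen_dcc (S : nat -> V -> Prop) : flen (S 0) -> (forall n, submod (S n)) ->
  (forall n x, S n.+1 x -> S n x) ->
  exists n, forall m, (n <= m)%N -> forall x, S n x -> S m x.
Proof.
move=> fS0 sS decS; have leS m n : (m <= n)%N -> forall x, S n x -> S m x.
  elim: n => [|n IH] in m *; first by rewrite leqn0 => /eqP->.
  by rewrite leq_eqVlt ltnS => /orP[/eqP->//|/IH{}IH] x /decS /IH.
have [|T [sT [n Tn] _ minT]] :=
  @flen_min (fun T => exists n, forall x, T x <-> S n x) (S 0) fS0 (sS 0).
- by exists 0%N.
- exists n => m nm x /Tn Tx; apply: (minT (S m)) => //; first by exists m.
  by move=> y /(leS _ _ nm) /Tn.
Qed.

(** Take a maximal finitely spanned submodule of S: an element of S outside it could be prepended to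
    its generators. *)
Lemma flen_gen S : flenT V -> submod S -> exists n (g : 'I_n -> V),
  (forall i, S (g i)) /\
  forall x, S x -> exists c : 'I_n -> A, x = \sum_(i < n) c i *: g i.
Proof.
move=> fV sS.
have [|T [sT [n [g [gS gT]]] _ maxT]] := @flen_max (fun T => exists n (g : 'I_n -> V),
  (forall i, S (g i)) /\
  forall x, T x <-> exists c : 'I_n -> A, x = \sum_(i < n) c i *: g i) _ fV
  (submod_eq0 V).
  exists 0%N, (fun=> 0); split=> [[]//|x]; split=> [->|[c ->]].
    by exists (fun=> 0); rewrite big_ord0.
  by rewrite big_ord0.
exists n, g; split=> // x Sx; apply/gT.
pose g' (i : 'I_n.+1) := if unlift ord0 i is Some j then g j else x.
have g'E c : \sum_i c i *: g' i = c ord0 *: x + \sum_i c (lift ord0 i) *: g i.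
  rewrite big_ord_recl /g' unlift_none; congr (_ + _).
  by apply: eq_bigr => i _; rewrite liftK.
apply: (maxT (fun y => exists c : 'I_n.+1 -> A, y = \sum_i c i *: g' i)).
- exact: submod_span.
- exists n.+1, g'; split=> // i; rewrite /g'.
  by case: unliftP => [j _|_].
- move=> y /gT[c ->].
  exists (fun i => if unlift ord0 i is Some j then c j else 0).
  rewrite g'E unlift_none scale0r add0r.
  by apply: eq_bigr => i _; rewrite liftK.
- exists (fun i => if unlift ord0 i is Some j then 0 else 1).
  rewrite g'E unlift_none scale1r big1 ?addr0// => i _.
  by rewrite liftK scale0r.
Qed.

Lemma flen_fin_gen : flenT V -> fin_gen V.
Proof.
move=> fV; have [n [g [_ gV]]] := flen_gen fV (submodT V).
by exists n, g => x; apply: gV.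
Qed.

End Length.

(** * Length of kernels, images and extensions *)

Section LengthMaps.
Variables V W : lmodType A.

(** At each strict step of the chain either the intersection with the kernel drops or, if it does
    not, the image drops. *)
Lemma chain_ker (f : {linear V -> W}) n (S : V -> Prop) : submod S -> chain n S ->
  exists a b, [/\ (n <= a + b)%N, chain a (fun x => S x /\ f x = 0) &
    chain b (fun y => exists2 x, S x & y = f x)].
Proof.
elim: n S => [|n IH] S sS; first by exists 0%N, 0%N.
move=> [T [sT TS [x Sx Tx] cT]].
have [a [b [nab cTa cTb]]] := IH T sT cT.
have [TK|] := pselect (forall y, S y -> f y = 0 -> T y).
  exists a, b.+1; rewrite addnS; split=> //; first by apply: chain_sub cTa => y [/TS].
  exists (fun y => exists2 x, T x & y = f x); split=> //.
  - exact: submod_image.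
  - by move=> _ [y /TS Sy ->]; exists y.
  - exists (f x); first by exists x.
    move=> [t Tt fxt]; apply: Tx; rewrite -(subrK t x); apply: submodD => //.
    apply: TK; first by apply: submodB => //; apply: TS.
    by rewrite linearB fxt subrr.
move=> /existsNP[y] /not_implyP[Sy] /not_implyP[fy Ty].
exists a.+1, b; rewrite addSn; split=> //; last first.
  by apply: chain_sub cTb => _ [z /TS Sz ->]; exists z.
exists (fun x => T x /\ f x = 0); split=> //.
- by apply: submodI => //; apply: submod_ker.
- by move=> z [/TS].
- by exists y => // -[].
Qed.

Lemma flen_ker (f : {linear V -> W}) (S : V -> Prop) : submod S ->
  flen (fun x => S x /\ f x = 0) -> flen (fun y => exists2 x, S x & y = f x) ->
  flen S.
Proof.
move=> sS [n nK] [m nW]; exists (n + m)%N => /(chain_ker f sS)[a [b [ab ca cb]]].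
have [na|an] := leqP n a; first by apply: nK; apply: chain_le ca.
apply: nW; apply: chain_le cb; rewrite -(leq_add2l n).
by apply: leq_trans ab _; rewrite leq_add2r ltnW.
Qed.

Lemma flen_preim (f : {linear V -> W}) : (forall y, exists x, f x = y) ->
  flenT V -> flenT W.
Proof.
move=> fS [n nV]; exists n => cW; apply: nV.
suff: forall S : W -> Prop, chain n S -> chain n (fun x => S (f x)).
  by move=> /(_ (fun=> True)); apply.
elim: n {cW} => // n IH S [T [sT TS [y Sy Ty] cT]].
exists (fun x => T (f x)); split=> //.
- exact: submod_preim.
- by move=> x /TS.
- by have [x fx] := fS y; exists x; rewrite fx.
- exact: IH.
Qed.

Lemma chain_image (f : {linear V -> W}) n (S : V -> Prop) : injective f ->
  chain n S -> chain n (fun y => exists2 x, S x & y = f x).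
Proof.
move=> fI; elim: n S => // n IH S [T [sT TS [x Sx Tx] cT]].
exists (fun y => exists2 x, T x & y = f x); split=> //.
- exact: submod_image.
- by move=> _ [z /TS Sz ->]; exists z.
- by exists (f x); [exists x|move=> [z Tz /fI xz]; apply: Tx; rewrite xz].
- exact: IH.
Qed.

Lemma flen_inj (f : {linear V -> W}) : injective f -> flenT W -> flenT V.
Proof.
move=> fI [n nW]; exists n => /(chain_image fI) cV.
by apply: nW; apply: chain_sub cV.
Qed.

End LengthMaps.

Lemma flen_zero (V : lmodType A) (S : V -> Prop) :
  (forall x, S x -> x = 0) -> flen S.
Proof.
move=> S0; exists 1%N => -[T [sT _ [x /S0-> T0] _]].
by apply: T0; apply: submod0.
Qed.

Lemma flen_prod (V W : lmodType A) :
  flenT V -> flenT W -> flenT (V * W)%type.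
Proof.
move=> fV fW; apply: (flen_ker (f := fst : {linear (V * W)%type -> V})) => //;
  last exact: flen_all.
apply: (flen_ker (f := snd : {linear (V * W)%type -> W}));
  last exact: flen_all.
  by apply: submodI => //; apply: submod_ker.
by apply: flen_zero => -[x y] /= [[_ ->] ->].
Qed.

(** Each map accounts for fewer than b steps by [chain_ker]; splitting the maps off one at a time
    leaves the common kernel, which accounts for fewer than a. *)
Lemma chain_joint (V W : lmodType A) n (f : 'I_n -> {linear V -> W})
    (S : V -> Prop) (T : W -> Prop) a b : submod S ->
  (forall i x, S x -> T (f i x)) ->
  ~ chain a (fun x => S x /\ forall i, f i x = 0) -> ~ chain b T ->
  ~ chain (a + n * b) S.
Proof.
elim: n f S => [|n IH] f S sS fT na nb.
  rewrite mul0n addn0 => cS; apply: na; apply: chain_sub cS => x Sx.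
  by split=> // -[].
move=> /(chain_ker (f ord0) sS)[a' [b' [ab ca cb]]].
have cbT : chain b' T by apply: chain_sub cb => _ [x Sx ->]; apply: fT.
have b'b : (b' < b)%N.
  by rewrite ltnNge; apply/negP => bb'; apply: nb; apply: chain_le cbT.
have sS' := submodI sS (submod_ker (f ord0)).
have a'a : (a' < a + n * b)%N.
  rewrite ltnNge; apply/negP => aa'.
  apply: (IH (fun i => f (lift ord0 i)) _ sS' _ _ nb (chain_le aa' ca)).
    by move=> i x [/fT].
  apply: contra_not na; apply: chain_sub => x [[Sx f0] fl]; split=> // i.
  by case: (unliftP ord0 i) => [j ->|->].
have : (a' + b' < a + n.+1 * b)%N.
  by rewrite mulSn addnCA addnC -addnS; apply: leq_add; [exact: ltnW|].
by rewrite ltnNge ab.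
Qed.

Lemma flen_joint (V W : lmodType A) n (f : 'I_n -> {linear V -> W}) :
  flenT W -> (forall x, (forall i, f i x = 0) -> x = 0) -> flenT V.
Proof.
move=> [b nW] fI; exists (1 + n * b)%N; apply: (chain_joint (f := f) _ _ _ nW) => //.
move=> [T [sT _ [x [_ fx] Tx] _]]; apply: Tx; rewrite (fI _ fx); exact: submod0.
Qed.

End Submodules.

(** * Artinian rings have finite length *)

Section Artinian.

(** The hypothesis says that (S + A x) / S is zero or simple. Intersecting a chain in S + A x with S
    therefore loses at most one step. *)
Lemma flen_add_simple (A : pzRingType) (V : lmodType A) (S : V -> Prop) (x : V) :
  submod S -> (forall a, ~ S (a *: x) -> exists e, S (x - e *: (a *: x))) ->
  flen S -> flen (fun y => exists s a, S s /\ y = s + a *: x).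
Proof.
move=> sS Sx [n nS]; exists n.+1 => cU.
suff: forall c U, submod U -> chain c.+1 U ->
    (forall y, U y -> exists s a, S s /\ y = s + a *: x) ->
    chain c (fun y => U y /\ S y).
  move=> claim; apply: nS; suff: chain n (fun y => (exists s a, S s /\ y = s + a *: x) /\ S y).
    by apply: chain_sub => y [].
  apply: claim => //; split; first by exists 0, 0; rewrite scale0r addr0; split=> //; apply: submod0.
  move=> c _ _ [s [a [Ss ->]]] [s' [a' [Ss' ->]]].
  exists (c *: s + s'), (c * a + a'); split; first by case: sS => _; apply.
  by rewrite scalerDr scalerA scalerDl addrACA.
elim=> // c IH U sU [T [sT TU [u Uu Tu] cT]] USx.
have cTS : chain c (fun y => T y /\ S y) by apply: IH => // y /TU /USx.
(* If U and T have the same intersection with S, then T lies in S: given t in T outside S, any u in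
   U can be moved into S by a multiple of t, hence lies in T. *)
have [TS|] := pselect (forall y, U y -> S y -> T y); last first.
  move=> /existsNP[y] /not_implyP[Uy] /not_implyP[Sy Ty].
  exists (fun y => T y /\ S y); split=> //.
  - exact: submodI.
  - by move=> z [/TU].
  - by exists y => // -[].
apply: (chain_sub (n := c.+1) _ cT) => t Tt; split; first exact: TU.
apply: contrapT => St.
have [s [a [Ss tE]]] := USx _ (TU _ Tt).
have [s' [b [Ss' uE]]] := USx _ Uu.
have [|e Se] := Sx a; first by move=> Sax; apply: St; rewrite tE; apply: submodD.
apply: Tu; rewrite -(subrK (b *: (e *: t)) u); apply: submodD => //; last first.
  by do 2!apply: submodZ => //.
apply: TS; first by apply: submodB => //; do 2!apply: submodZ => //; apply: TU.
have -> : u - b *: (e *: t) = s' - b *: (e *: s) + b *: (x - e *: (a *: x)).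
  by rewrite uE tE !scalerDr !opprD !scalerN addrACA.
apply: submodD => //; last exact: submodZ.
by apply: submodB => //; do 2!apply: submodZ => //.
Qed.

Variable R : comNzRingType.
Hypothesis artR : artinian R.
Let V : lmodType R := R^o.

(** Without a minimal element, choice yields an infinite strictly descending sequence of ideals. *)
Lemma artinian_min (P : (V -> Prop) -> Prop) S : submod S -> P S ->
  exists T, [/\ submod T, P T &
    forall U, submod U -> P U -> (forall x, U x -> T x) -> forall x, T x -> U x].
Proof.
move=> sS PS; apply: contrapT => nomin.
pose ty := {T | submod T /\ P T}.
have next (s : ty) : exists t : ty, (forall x, projT1 t x -> projT1 s x) /\
    ~ (forall x, projT1 s x -> projT1 t x).
  case: s => T [sT PT] /=; apply: contrapT => notx; apply: nomin; exists T; split=> //.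
  move=> U sU PU UT; apply: contrapT => TU; apply: notx.
  by exists (exist _ U (conj sU PU)).
case/choice: next => f fP.
pose s n := iter n f (exist _ S (conj sS PS) : ty).
have [||n nP] := artR (I := fun n => (fun x => `[<projT1 (s n) x>]) : {pred R^o}).
- move=> n; case: (projT2 (s n)) => -[s0 sD] _; split; first exact/asboolP.
  by move=> a x y /asboolP sx /asboolP sy; apply/asboolP; apply: sD.
- by move=> n x /asboolP /((fP (s n)).1 _) fx; apply/asboolP.
- case: (fP (s n)) => _; apply=> x snx.
  have e : `[<projT1 (s n.+1) x>] = `[<projT1 (s n) x>] := nP n.+1 (leqnSn n) x.
  by apply/asboolP; rewrite -/(s n.+1) e; apply/asboolP.
Qed.

(** The spans [N k] of the tails x_k, x_(k+1), .. descend, so two consecutive ones agree and x_k is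
    a combination of later terms. Coefficients are functions on [nat] vanishing beyond a cut-off, so
    that sums of different lengths can be added. *)
Lemma artinian_dependent (x : nat -> V) :
  exists k n (c : nat -> R), (forall i, (i <= k)%N -> c i = 0) /\
    x k = \sum_(i < n) c i *: x i.
Proof.
pose N k y := exists (c : nat -> R) n, [/\ forall i, (n <= i)%N -> c i = 0,
  forall i, (i < k)%N -> c i = 0 & y = \sum_(i < n) c i *: x i].
have ext (c : nat -> R) n m : (n <= m)%N -> (forall i, (n <= i)%N -> c i = 0) ->
    \sum_(i < n) c i *: x i = \sum_(i < m) c i *: x i.
  move=> nm c0; rewrite -!(big_mkord xpredT (fun i => c i *: x i)).
  rewrite (big_cat_nat (leq0n n) nm)//= [X in _ = _ + X]big_nat_cond [X in _ = _ + X]big1 ?addr0//.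
  by move=> i; rewrite andbT => /andP[ni _]; rewrite c0// scale0r.
have sN k : submod (N k : V -> Prop).
  split.
    by exists (fun=> 0), 0%N; split=> //; rewrite big_ord0.
  move=> a _ _ [c [n [cn ck ->]]] [c' [n' [cn' ck' ->]]].
  exists (fun i => a * c i + c' i), (maxn n n'); split=> [i|i ik|].
  - by rewrite geq_max => /andP[/cn-> /cn'->]; rewrite mulr0 addr0.
  - by rewrite ck// ck'// mulr0 addr0.
  - rewrite (ext c _ _ (leq_maxl n n'))// (ext c' _ _ (leq_maxr n n'))//.
    rewrite scaler_sumr -big_split/=; apply: eq_bigr => i _.
    by rewrite scalerDl scalerA.
have eN n : exists m, forall y, N n y <-> N m y by exists n.
have [T [sT [k Nk] minT]] :=
  artinian_min (P := fun T => exists n, forall y, T y <-> N n y) (sN 0%N) (eN 0%N).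
exists k; have [||c [n [_ ck xk]]] := minT _ (sN k.+1) (eN k.+1) _ (x k).
- move=> y [c [n [cn ck ->]]]; apply/Nk; exists c, n; split=> // i ik.
  by apply: ck; apply: ltnW.
- apply/Nk; exists (fun i => (i == k)%:R), k.+1; split=> [i ki|i ik|].
  + by rewrite gtn_eqF.
  + by rewrite ltn_eqF.
  + rewrite big_ord_recr/= eqxx scale1r big1 ?add0r// => i _.
    by rewrite ltn_eqF// scale0r.
- by exists n, c.
Qed.

(* An ideal I minimal among those of infinite length satisfies r I = 0 or
   r I = I for every r. Hence P = ann(I) is prime, R / P is an artinian domain,
   that is a field, and I is an R / P-vector space; the tails of an infinite
   independent sequence in I contradict the descending chain condition. *)
Theorem artinian_flen : flenT V.
Proof.
apply: contrapT => nV.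
have [I [sI nI minI]] := artinian_min (P := fun S => ~ flen S) (submodT V) nV.
pose P r := forall x, I x -> r *: x = 0.
have dich r : P r \/ forall y, I y -> exists2 x, I x & y = r *: x.
  have [rI|] := pselect (forall y, I y -> exists2 x, I x & y = r *: x); first by right.
  (* A proper submodule r I has finite length by minimality of I; the kernel of r on I then has
     infinite length, so it is all of I. *)
  move=> rI; left.
  have rL : linear (fun x : V => r *: x : V).
    by move=> a y z; rewrite scalerDr !scalerA mulrC.
  pose f := mklin rL.
  have fIm : flen (fun y => exists2 x, I x & y = f x).
    apply: contrapT => nf; apply: rI; apply: (minI (fun y => exists2 x, I x & y = f x)) => //.
      exact: submod_image.
    by move=> _ [x Ix ->]; apply: submodZ.
  have sK := submodI sI (submod_ker f).
  move=> x Ix; suff: I x /\ f x = 0 by case.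
  apply: (minI _ sK) => //; last by move=> y [].
  by move=> fK; apply: nI; apply: (flen_ker (f := f)).
have PB r r' : P r -> P r' -> P (r - r').
  by move=> Pr Pr' x Ix; rewrite scalerBl Pr// Pr'// subrr.
have PM a r : P r -> P (a * r).
  by move=> Pr x Ix; rewrite -scalerA Pr// scaler0.
have inv r : ~ P r -> exists s, forall x, I x -> s *: (r *: x) = x.
  move=> nPr; have [//|rI] := dich r.
  (* J n is the ideal P + (r^n). Once it is stable, r^n = b r^(n+1) modulo P, and since every x in I
     has the form r^n y, b inverts r on I. *)
  pose J n a := exists b, P (a - b * r ^+ n).
  have sJ n : submod (J n : V -> Prop).
    split; first by exists 0; rewrite mul0r subr0 => x Ix; rewrite scale0r.
    move=> c a a' [b Pb] [b' Pb']; exists (c * b + b') => x Ix.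
    rewrite mulrDl opprD -mulrA addrACA -mulrBr scalerDl Pb'// addr0.
    by rewrite -scalerA Pb ?scaler0.
  have eJ n : exists m, forall x, J n x <-> J m x by exists n.
  have [T [sT [n Jn] minT]] := artinian_min
    (P := fun T => exists n, forall x, T x <-> J n x) (sJ 0%N) (eJ 0%N).
  have [||b Pb] := minT _ (sJ n.+1) (eJ n.+1) _ (r ^+ n).
  - move=> a [b Pb]; apply/Jn; exists (b * r).
    by rewrite -mulrA -exprS.
  - by apply/Jn; exists 1; rewrite mul1r subrr => x Ix; rewrite scale0r.
  exists b => x Ix.
  have {Ix}[y Iy ->] : exists2 y, I y & x = r ^+ n *: y.
    elim: n x Ix {Jn Pb} => [|n IH] x Ix; first by exists x; rewrite ?scale1r.
    have [y Iy ->] := rI x Ix; have [z Iz ->] := IH y Iy.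
    by exists z; rewrite // scalerA -exprS.
  apply/esym/eqP; rewrite -subr_eq0; apply/eqP.
  by rewrite -[RHS](Pb y Iy) scalerBl exprS !scalerA mulrA.
(* A submodule of finite length misses some [x S] in I. Adjoining it keeps the length finite,
   because scalars outside P are invertible on I; iterating gives an independent sequence. *)
pose ty := {S : V -> Prop | [/\ submod S, flen S & forall x, S x -> I x]}.
have ext (S : ty) : exists x, I x /\ ~ projT1 S x.
  case: S => S [sS fS SI] /=; apply: contrapT => /forallNP IS; apply: nI.
  by apply: flen_sub fS => x Ix; apply: contrapT => Sx; apply: (IS x).
case/choice: ext => x xP.
have next (S : ty) : exists T : ty, (forall y, projT1 S y -> projT1 T y) /\
    projT1 T (x S).
  case: (xP S); case: S (x S) => S [sS fS SI] /= {xP}x Ix nSx.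
  pose T y := exists s a, S s /\ y = s + a *: x.
  suff TP : [/\ submod T, flen T & forall x, T x -> I x].
    exists (exist _ T TP); split=> /= [y Sy|].
      by exists y, 0; rewrite scale0r addr0.
    by exists 0, 1; rewrite scale1r add0r; split=> //; apply: submod0.
  split.
  - have := submod_add sS (submod_cyclic x).
    congr submod; apply/funext => y; apply/propext; split.
      by move=> [s [_ [Ss [a ->] ->]]]; exists s, a.
    by move=> [s [a [Ss ->]]]; exists s, (a *: x); split=> //; exists a.
  - apply: flen_add_simple => // a Sax.
    have [|s sx] := inv a; last by exists s; rewrite sx// subrr; apply: submod0.
    by move=> /(_ _ Ix) ax; apply: Sax; rewrite ax; apply: submod0.
  - by move=> _ [s [a [Ss ->]]]; apply: submodD => //; [apply: SI|apply: submodZ].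
case/choice: next => f fP.
have S0P : [/\ submod (fun y : V => y = 0), flen (fun y : V => y = 0) &
    forall x, x = 0 -> I x].
  by split; [exact: submod_eq0|exact: flen_zero|move=> _ ->; apply: submod0].
pose S n := iter n f (exist _ _ S0P : ty).
have sS n : submod (projT1 (S n)) by case: (projT2 (S n)).
have leS m n y : (m <= n)%N -> projT1 (S m) y -> projT1 (S n) y.
  elim: n => [|n IH]; first by rewrite leqn0 => /eqP->.
  rewrite leq_eqVlt ltnS => /orP[/eqP->//|mn] Sy.
  by apply: (fP (S n)).1; apply: IH.
have [k [n [c [ck xk]]]] := artinian_dependent (fun n => x (S n)).
(* Drop the last term as long as its coefficient kills I. The first surviving coefficient is
   invertible on I and would put [x (S n)] into [S n]; if none survives, [x (S k)] is zero. *)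
elim: n xk => [|n IH] xk.
  by apply: (xP (S k)).2; rewrite xk big_ord0; apply: submod0.
move: xk; rewrite big_ord_recr/= => xk.
have [Pc|nPc] := pselect (P (c n)).
  by apply: IH; rewrite xk Pc ?addr0//; case: (xP (S n)).
have kn : (k < n)%N.
  by rewrite ltnNge; apply/negP => /ck c0; apply: nPc => y _; rewrite c0 scale0r.
have [s sP] := inv _ nPc; have [Ix] := xP (S n); apply.
rewrite -(sP _ Ix); apply: submodZ => //.
have -> : c n *: x (S n) = x (S k) - \sum_(i < n) c i *: x (S i).
  by rewrite xk addrAC subrr add0r.
have xS i : (i < n)%N -> projT1 (S n) (x (S i)).
  by move=> /leS; apply; case: (fP (S i)).
apply: submodB; [exact: sS|exact: xS|].
by apply: submod_sum => // i; apply: submodZ => //; apply: xS.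
Qed.

End Artinian.

(** * Submodules, quotients and restriction of scalars *)

Section SubmoduleType.
Variables (A : pzRingType) (V : lmodType A) (S : V -> Prop) (sS : submod S).

Definition submod_pred : pred V := fun x => `[<S x>].

Lemma submod_predP : submod_closed submod_pred.
Proof.
case: sS => S0 SD; split; first exact/asboolP.
by move=> a x y /asboolP Sx /asboolP Sy; apply/asboolP; apply: SD.
Qed.

Definition submod_closedP : submodClosed V :=
  HB.pack submod_pred
    (GRing.isZmodClosed.Build V submod_pred (GRing.submod_closedB submod_predP))
    (GRing.isScaleClosed.Build A V submod_pred (GRing.subsemimod_closedZ (GRing.submod_closed_semi submod_predP))).

Record submod_type := SubmodType
  { submod_val :> V; submod_valP : submod_val \in submod_closedP }.

HB.instance Definition _ := [isSub for submod_val].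
HB.instance Definition _ := [Choice of submod_type by <:].
HB.instance Definition _ := [SubChoice_isSubLmodule of submod_type by <:].

Lemma submod_val_linear : linear (submod_val : submod_type -> V).
Proof. exact: linearP (val : {linear submod_type -> V}). Qed.

Definition submod_incl : {linear submod_type -> V} := mklin submod_val_linear.

Lemma submod_incl_inj : injective submod_incl.
Proof. exact: val_inj. Qed.

Lemma submod_inclP x : S (submod_incl x).
Proof. by apply/asboolP; case: x. Qed.

Lemma submod_incl_surj x : S x -> exists y, submod_incl y = x.
Proof. by move=> /asboolP Sx; exists (SubmodType Sx). Qed.

Lemma submod_lift (U : lmodType A) (f : {linear U -> V}) :
  (forall u, S (f u)) -> exists g : {linear U -> submod_type}, forall u, submod_incl (g u) = f u.
Proof.
move=> fS; have /choice[g gE] u := submod_incl_surj (fS u).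
have gL : linear g.
  by move=> a x y; apply: submod_incl_inj; rewrite linearP !gE linearP.
by exists (mklin gL).
Qed.

End SubmoduleType.

Section QuotientModule.
Variables (A : pzRingType) (V : lmodType A) (S : V -> Prop) (sS : submod S).

Let Sz : zmodClosed V := HB.pack (submod_pred S)
  (GRing.isZmodClosed.Build V (submod_pred S) (GRing.submod_closedB (submod_predP sS))).

Definition quotmod : Type := Quotient.quot Sz.
HB.instance Definition _ := GRing.Zmodule.copy quotmod (Quotient.quot Sz).

Definition quotmod_pi (x : V) : quotmod := \pi_(Quotient.quot Sz) x.

Lemma quotmod_pi_eq x y : quotmod_pi x = quotmod_pi y <-> S (x - y).
Proof.
split=> [/eqP|Sxy]; first by rewrite -Quotient.idealrBE => /asboolP.
by apply/eqP; rewrite -Quotient.idealrBE; apply/asboolP.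
Qed.

Lemma quotmod_piD : {morph quotmod_pi : x y / x + y}.
Proof. by move=> x y; rewrite /quotmod_pi raddfD. Qed.

Lemma quotmod_surj y : exists x, quotmod_pi x = y.
Proof. by exists (repr (y : Quotient.quot Sz)); rewrite /quotmod_pi reprK. Qed.

Definition quotmod_scale (a : A) (y : quotmod) : quotmod :=
  quotmod_pi (a *: repr (y : Quotient.quot Sz)).

Lemma quotmod_scaleE a x : quotmod_scale a (quotmod_pi x) = quotmod_pi (a *: x).
Proof.
apply/quotmod_pi_eq; rewrite -scalerBr; apply: submodZ => //.
by apply/quotmod_pi_eq; rewrite /quotmod_pi reprK.
Qed.

Fact quotmod_scaleA a b v :
  quotmod_scale a (quotmod_scale b v) = quotmod_scale (a * b) v.
Proof. by have [x <-] := quotmod_surj v; rewrite !quotmod_scaleE scalerA. Qed.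

Fact quotmod_scale1 : left_id 1 quotmod_scale.
Proof. by move=> v; have [x <-] := quotmod_surj v; rewrite quotmod_scaleE scale1r. Qed.

Fact quotmod_scaleDr : right_distributive quotmod_scale +%R.
Proof.
move=> a u v; have [x <-] := quotmod_surj u; have [y <-] := quotmod_surj v.
by rewrite -quotmod_piD !quotmod_scaleE scalerDr quotmod_piD.
Qed.

Fact quotmod_scaleDl v : {morph quotmod_scale^~ v : a b / a + b}.
Proof.
move=> a b; have [x <-] := quotmod_surj v.
by rewrite !quotmod_scaleE scalerDl quotmod_piD.
Qed.

HB.instance Definition _ := GRing.Zmodule_isLmodule.Build A quotmod
  quotmod_scaleA quotmod_scale1 quotmod_scaleDr quotmod_scaleDl.

Lemma quotmod_pi_linear : linear quotmod_pi.
Proof. by move=> a x y; rewrite quotmod_piD -quotmod_scaleE. Qed.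

Definition quot_proj : {linear V -> quotmod} := mklin quotmod_pi_linear.

Lemma quot_proj_surj y : exists x, quot_proj x = y.
Proof. exact: quotmod_surj. Qed.

Lemma quot_proj_eq0 x : quot_proj x = 0 <-> S x.
Proof. by rewrite -(linear0 quot_proj) /= quotmod_pi_eq subr0. Qed.

Lemma quot_factor (U : lmodType A) (f : {linear V -> U}) :
  (forall x, S x -> f x = 0) -> exists g : {linear quotmod -> U}, forall x, g (quot_proj x) = f x.
Proof.
move=> fS; have /choice[r rE] := quot_proj_surj.
have gE x : f (r (quot_proj x)) = f x.
  apply/eqP; rewrite -subr_eq0 -linearB; apply/eqP/fS/quot_proj_eq0.
  by rewrite linearB rE subrr.
have gL : linear (f \o r).
  move=> a y z; have [[y' <-] [z' <-]] := (quot_proj_surj y, quot_proj_surj z).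
  by rewrite -linearP /= !gE linearP.
by exists (mklin gL).
Qed.

End QuotientModule.

(** * Restriction of scalars to R, and finite length of finitely generated modules over L *)

Section Restriction.
Variables (R : comNzRingType) (L : algType R).

Section RestrType.
Variable M : lmodType L.
(** An alias of M, so that the actions of L and R can coexist on the same elements. *)
Definition restr : Type := M.
HB.instance Definition _ := GRing.Zmodule.copy restr M.

Definition restr_scale (r : R) (x : restr) : restr := (r%:A : L) *: (x : M).

Fact restr_scaleA a b v : restr_scale a (restr_scale b v) = restr_scale (a * b) v.
Proof. by rewrite /restr_scale scalerA -scalerAl mul1r scalerA. Qed.

Fact restr_scale1 : left_id 1 restr_scale.
Proof. by move=> v; rewrite /restr_scale !scale1r. Qed.

Fact restr_scaleDr : right_distributive restr_scale +%R.
Proof. by move=> a u v; rewrite /restr_scale scalerDr. Qed.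

Fact restr_scaleDl v : {morph restr_scale^~ v : a b / a + b}.
Proof. by move=> a b; rewrite /restr_scale !scalerDl. Qed.

HB.instance Definition _ := GRing.Zmodule_isLmodule.Build R restr
  restr_scaleA restr_scale1 restr_scaleDr restr_scaleDl.
End RestrType.

Lemma restrZ (M : lmodType L) (r : R) (x : restr M) :
  r *: x = ((r%:A : L) *: (x : M) : restr M).
Proof. by []. Qed.

Lemma restr_scaleC (M : lmodType L) (r : R) (a : L) (x : M) :
  a *: (r *: (x : restr M) : M) = (r *: ((a *: x : M) : restr M) : M).
Proof. by rewrite !restrZ !scalerA -scalerAr -scalerAl mulr1 mul1r. Qed.

Lemma restr_scaleAl (M : lmodType L) (r : R) (a : L) (x : M) :
  ((r *: a) *: x : M) = (r *: ((a *: x : M) : restr M) : M).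
Proof. by rewrite restrZ scalerA -scalerAl mul1r. Qed.

Fact restr_map_linear (X Y : lmodType L) (f : {linear X -> Y}) :
  linear (fun x : restr X => f x : restr Y).
Proof. by move=> a x y; rewrite !restrZ linearP. Qed.

Definition restr_map (X Y : lmodType L) (f : {linear X -> Y}) : {linear restr X -> restr Y} :=
  mklin (restr_map_linear f).

Lemma submod_restr (M : lmodType L) (S : M -> Prop) :
  submod S -> submod (S : restr M -> Prop).
Proof. by move=> [S0 SD]; split=> // a x y; apply: SD. Qed.

Lemma flen_restr (M : lmodType L) (S : M -> Prop) :
  flen (S : restr M -> Prop) -> flen S.
Proof.
move=> [n nS]; exists n => cS; apply: nS.
elim: n S cS => // n IH S [T [sT TS xT cT]].
by exists T; split=> //; [exact: submod_restr|exact: IH].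
Qed.

Lemma flen_restr_fin_gen (M : lmodType L) : flenT (restr M) -> fin_gen M.
Proof. by move=> /flen_restr /flen_fin_gen. Qed.

Lemma flen_ffun (V : lmodType R) n : flenT V -> flenT {ffun 'I_n -> V}.
Proof.
move=> fV.
have evL i : linear (fun f : {ffun 'I_n -> V} => f i) by move=> a f g; rewrite !ffunE.
apply: (flen_joint (f := fun i => mklin (evL i)) fV) => f f0.
by apply/ffunP => i; rewrite ffunE; exact: f0.
Qed.

Lemma comb_linear (V : lmodType R) n (g : 'I_n -> V) :
  linear (fun c : {ffun 'I_n -> R^o} => \sum_i c i *: g i : V).
Proof.
move=> a c d; rewrite scaler_sumr -big_split/=; apply: eq_bigr => i _.
by rewrite !ffunE scalerDl scalerA.
Qed.

Lemma artinian_fin_gen_flen (V : lmodType R) : artinian R -> fin_gen V -> flenT V.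
Proof.
move=> artR [n [g gV]]; apply: (flen_preim (f := mklin (comb_linear g))).
  by move=> x; have [c ->] := gV x; exists [ffun i => c i]; apply: eq_bigr => i _; rewrite ffunE.
exact: flen_ffun (artinian_flen artR).
Qed.

Hypothesis artL : artin_algebra L.

Lemma flen_alg : flenT (L : lmodType R).
Proof. by case: artL => artR; apply: artinian_fin_gen_flen. Qed.

Lemma fin_gen_flen (M : lmodType L) : fin_gen M -> flenT (restr M).
Proof.
move=> [n [g gM]].
have fL : linear (fun c : {ffun 'I_n -> L} => \sum_i c i *: (g i : M) : restr M).
  move=> a c d; rewrite scaler_sumr -big_split/=; apply: eq_bigr => i _.
  by rewrite !ffunE scalerDl restr_scaleAl.
apply: (flen_preim (f := mklin fL)); last exact/flen_ffun/flen_alg.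
by move=> x; have [c ->] := gM x; exists [ffun i => c i]; apply: eq_bigr => i _; rewrite ffunE.
Qed.

End Restriction.

(** * Fitting's lemma and the radical *)

Section Fitting.
Variables (A : pzRingType) (X : lmodType A).
Hypothesis fX : flenT X.
Implicit Types u : {linear X -> X}.

(** A proper image u X would give strictly descending chains X, u X, u^2 X, .. of every length. *)
Lemma inj_iso u : injective u -> isomorphism u.
Proof.
move=> uI; apply: iso_of_bij => // y; apply: contrapT => /forallNP yu.
have [n nX] := fX; apply: nX; elim: n => // n /(chain_image uI) cX.
exists (fun y => exists2 x, True & y = u x); split=> //.
  exact: submod_image.
by exists y => // -[x _ /esym/yu].
Qed.

Lemma sum_iso (S T : X -> Prop) (sS : submod S) (sT : submod T) :
  (forall x, S x -> T x -> x = 0) ->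
  (forall x, exists s t, [/\ S s, T t & x = s + t]) ->
  isomorphic X (submod_type sS * submod_type sT)%type.
Proof.
move=> ST0 STX; apply: isomorphic_sym.
have fL : linear (fun p : submod_type sS * submod_type sT =>
    submod_incl sS p.1 + submod_incl sT p.2).
  by move=> a p q; rewrite !linearP scalerDr addrACA.
exists (mklin fL); apply: iso_of_bij => [[s t] [s' t'] /eqP|x].
  rewrite -subr_eq0 -linearB => /eqP st0.
  have {}st0 : submod_incl sS (s - s') + submod_incl sT (t - t') = 0 by [].
  have s0 : submod_incl sS (s - s') = 0.
    apply: ST0; first exact: submod_inclP.
    by move/eqP: st0; rewrite addr_eq0 -linearN => /eqP->; apply: submod_inclP.
  have t0 : submod_incl sT (t - t') = 0 by move: st0; rewrite s0 add0r.
  move: s0 t0; rewrite -{1}(linear0 (submod_incl sS)) -(linear0 (submod_incl sT)).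
  by move=> /submod_incl_inj/subr0_eq-> /submod_incl_inj/subr0_eq->.
have [s [t [/(submod_incl_surj sS)[s' <-] /(submod_incl_surj sT)[t' <-] ->]]] := STX x.
by exists (s', t').
Qed.

Fixpoint lin_iter n u : {linear X -> X} :=
  if n is n'.+1 then (u \o lin_iter n' u : {linear X -> X}) else idfun.

Lemma lin_iterE n u x : lin_iter n u x = iter n u x.
Proof. by elim: n => //= n ->. Qed.

(** X is the direct sum of the kernel and the image of u^N for large N, so one of the two
    vanishes. *)
Lemma fitting u : indecomposable X ->
  isomorphism u \/ exists n, forall x, iter n u x = 0.
Proof.
move=> [X0 iX].
have [|||k kD] := @flen_dcc _ X (fun n x => exists2 y, True & x = lin_iter n u y).
- exact: flen_all.
- by move=> n; apply: submod_image.
- by move=> n _ [y _ ->]; exists (u y); rewrite // !lin_iterE iterSr.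
have [|T [sT [m Tm] _ maxT]] := @flen_max _ X
  (fun T => exists m, forall x, T x <-> lin_iter m u x = 0) _ fX (submod_eq0 X).
  by exists 0%N.
(* Beyond k the images of the powers are stable, beyond m the kernels. The successor ensures that
   ker u lies in ker u^N. *)
pose N := (maxn k m).+1.
have kerN x : iter N u (iter N u x) = 0 -> iter N u x = 0.
  rewrite -iterD => xN; have : T x.
    apply: (maxT (fun x => lin_iter (N + N) u x = 0)).
    - exact: submod_ker.
    - by exists (N + N)%N.
    - move=> y /Tm; rewrite lin_iterE => ym.
      have mN : (m <= N + N)%N by rewrite (leq_trans _ (leq_addr _ _))// leqW// leq_maxr.
      by rewrite lin_iterE -(subnK mN) iterD ym -lin_iterE linear0.
    - by rewrite lin_iterE.
  have mN : (m <= N)%N by rewrite leqW// leq_maxr.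
  by move=> /Tm; rewrite lin_iterE -(subnK mN) iterD => ->; rewrite -lin_iterE linear0.
have imN x : exists y, iter N u x = iter N u (iter N u y).
  have kN : (k <= N)%N by rewrite leqW// leq_maxl.
  have kNN : (k <= N + N)%N by rewrite (leq_trans kN)// leq_addr.
  have [|y _ yE] := kD _ kNN (iter N u x).
    exists (iter (N - k) u x) => //.
    by rewrite lin_iterE -iterD subnKC.
  by exists y; rewrite -iterD yE lin_iterE.
have sK := submod_ker (lin_iter N u).
have sI := submod_image (lin_iter N u) (submodT X).
have [|K0|I0] := iX (submod_type sK) (submod_type sI); first apply: sum_iso.
- by move=> x + [y _ xE]; rewrite xE !lin_iterE => /kerN.
- move=> x; have [y yE] := imN x.
  exists (x - iter N u y), (iter N u y); split; last by rewrite subrK.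
    by rewrite linearB !lin_iterE yE subrr.
  by exists y; rewrite // lin_iterE.
- left; apply: inj_iso => x y /eqP; rewrite -subr_eq0 -linearB => /eqP uxy.
  apply/eqP; rewrite -subr_eq0; apply/eqP.
  have [|z <-] := submod_incl_surj sK (x := x - y); last by rewrite (K0 z) linear0.
  by rewrite lin_iterE /N iterSr uxy -lin_iterE linear0.
- right; exists N => x.
  have [|z <-] := submod_incl_surj sI (x := iter N u x); last by rewrite (I0 z) linear0.
  by exists x; rewrite // lin_iterE.
Qed.

Lemma ind_local u : indecomposable X ->
  isomorphism u \/ isomorphism ((idfun : {linear X -> X}) \- u : {linear X -> X}).
Proof.
move=> iX; have [|[n un]] := fitting u iX; first by left.
(* A point fixed by the nilpotent u is fixed by all its powers, hence zero. *)
right; apply: inj_iso => x y /eqP; rewrite -subr_eq0 -linearB /= => /eqP/subr0_eq xy.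
apply/eqP; rewrite -subr_eq0; apply/eqP; rewrite -(un (x - y)).
by elim: n {un} => //= n <-.
Qed.

End Fitting.

Section Radical.
Variable A : pzRingType.
Implicit Types X Y Z : lmodType A.

Lemma iso_comp X Y Z (f : {linear X -> Y}) (g : {linear Y -> Z}) :
  isomorphism f -> isomorphism g -> isomorphism (g \o f : {linear X -> Z}).
Proof.
move=> [f' [fK fK']] [g' [gK gK']]; exists (f' \o g' : {linear Z -> X}).
by split=> x /=; rewrite (gK, fK') ?fK ?gK'.
Qed.

(** If w inverts 1 - g f, then 1 + f w g inverts 1 - f g. *)
Lemma iso_swap X Y (f : {linear X -> Y}) (g : {linear Y -> X}) :
  isomorphism ((idfun : {linear X -> X}) \- (g \o f) : {linear X -> X}) ->
  isomorphism ((idfun : {linear Y -> Y}) \- (f \o g) : {linear Y -> Y}).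
Proof.
move=> [w [/= wK wK']].
exists ((idfun : {linear Y -> Y}) \+ (f \o (w \o g)) : {linear Y -> Y}).
split=> y /=.
  have E : w (g y - g (f (g y))) = g y by exact: wK.
  by rewrite [g (_ - _)]linearB E subrK.
have E : f (w (g y)) - f (g (f (w (g y)))) = f (g y).
  by rewrite -linearB; congr (f _); exact: wK'.
by rewrite [g (_ + _)]linearD linearD opprD addrACA E subrK.
Qed.

Section Rad.
Variables X Y : lmodType A.
Implicit Types f g h : {linear X -> Y}.

Lemma rad_compl Z h (k : {linear Y -> Z}) : rad h -> rad (k \o h : {linear X -> Z}).
Proof. by move=> hr g; exact: (hr (g \o k : {linear Y -> X})). Qed.

Lemma rad_compr Z h (k : {linear Z -> X}) : rad h -> rad (h \o k : {linear Z -> Y}).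
Proof.
move=> hr g; apply: (iso_swap (f := g \o h : {linear X -> Z}) (g := k)).
exact: (hr (k \o g : {linear Y -> X})).
Qed.

Lemma rad0 : rad (\0 : {linear X -> Y}).
Proof.
move=> g; exists idfun.
by split=> x /=; rewrite linear0 subr0.
Qed.

(** With a the inverse of 1 - k f, one has 1 - k (f + g) = (1 - k f) (1 - a k g). *)
Lemma radD f g : rad f -> rad g -> rad (f \+ g : {linear X -> Y}).
Proof.
move=> rf rg k; have [a [aK aK']] := rf k.
have ig := rg (a \o k : {linear Y -> X}).
have := iso_comp ig (rf k).
congr isomorphism; apply: linear_eq => x /=.
set u := k (g x); have E : a u - k (f (a u)) = u by exact: aK'.
rewrite [f (x - _)]linearB [k (f x - _)]linearB [k (f x + _)]linearD -/u -[X in _ = _ - (_ + X)]E.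
by rewrite !opprD !opprK -addrA; congr (_ + _); rewrite addrCA.
Qed.

Lemma rad_fixed h (g : {linear Y -> X}) x : rad h -> x = g (h x) -> x = 0.
Proof.
move=> /(_ g)/iso_inj inj xE; apply: inj.
by rewrite linear0 /= -xE subrr.
Qed.

Lemma rad_not_iso_r h (g : {linear Y -> X}) : ~ is_zero Y -> rad h ->
  ~ isomorphism (h \o g : {linear Y -> Y}).
Proof.
move=> Y0 hr [v [vK vK']]; apply: Y0 => y.
have g0 : g (v y) = 0.
  apply: (rad_fixed (g := g \o v : {linear Y -> X}) hr).
  by congr (g (v _)); rewrite [RHS]vK'.
by rewrite -[LHS]vK' /= g0 linear0.
Qed.

Lemma rad_not_iso_l h (g : {linear Y -> X}) : ~ is_zero X -> rad h ->
  ~ isomorphism (g \o h : {linear X -> X}).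
Proof.
move=> X0 hr [v [vK vK']]; apply: X0 => x.
by apply: (rad_fixed (g := v \o g : {linear Y -> X}) hr); rewrite [RHS]vK.
Qed.

(** An invertible h g would split h, so [ind_local] makes 1 - h g invertible, and [iso_swap] carries
    this over to 1 - g h. *)
Lemma rad_not_split_epi h : indecomposable Y -> flenT Y ->
  ~ (exists s : {linear Y -> X}, forall y, h (s y) = y) -> rad h.
Proof.
move=> iY fY nsp g; apply: iso_swap.
have [[v [vK vK']]|//] := ind_local fY (h \o g : {linear Y -> Y}) iY.
by case: nsp; exists (g \o v : {linear Y -> X}) => y; exact: vK'.
Qed.

Lemma rad_not_split_mono h : indecomposable X -> flenT X ->
  ~ (exists r : {linear Y -> X}, forall x, r (h x) = x) -> rad h.
Proof.
move=> iX fX nsp g.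
have [[v [vK vK']]|//] := ind_local fX (g \o h : {linear X -> X}) iX.
by case: nsp; exists (v \o g : {linear Y -> X}) => x; exact: vK.
Qed.

(** s h is idempotent. If it is invertible then h is injective; otherwise 1 - s h is injective and
    kills the image of s, so that s = 0 and Y = 0. *)
Lemma split_ind_isomorphic h (s : {linear Y -> X}) : indecomposable X -> flenT X ->
  ~ is_zero Y -> (forall y, h (s y) = y) -> isomorphic X Y.
Proof.
move=> iX fX Y0 hs; exists h; exists s; split=> [x|//].
have [si|/iso_inj si] := ind_local fX (s \o h : {linear X -> X}) iX.
  by apply: (iso_inj si); rewrite /= hs.
case: Y0 => y; rewrite -(hs y) (_ : s y = 0) ?linear0//.
by apply: si; rewrite linear0 /= hs subrr.
Qed.

End Rad.

End Radical.

(** * Powers of the radical *)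

Section RadPow.
Variables (A : pzRingType) (C : lmodType A -> Prop).
Implicit Types X Y Z : lmodType A.

Lemma rad_composite_compr i X Y Z (f : {linear Y -> Z}) (u : {linear X -> Y}) :
  rad_composite C i f -> rad_composite C i (f \o u : {linear X -> Z}).
Proof.
case: i => [|[|i]] //=; first exact: rad_compr.
move=> [W [h [k [CW rh ck fE]]]]; exists W, (h \o u : {linear X -> W}), k.
by split=> // [|x]; [exact: rad_compr|exact: fE].
Qed.

Lemma rad_composite_compl i X Y Z (f : {linear X -> Y}) (u : {linear Y -> Z}) :
  rad_composite C i f -> rad_composite C i (u \o f : {linear X -> Z}).
Proof.
elim: i X f => [//|[|i] IH] X f /=; first exact: rad_compl.
move=> [W [h [k [CW rh ck fE]]]]; exists W, h, (u \o k : {linear W -> Z}).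
by split=> // [|x]; [exact: (IH _ k)|rewrite /= fE].
Qed.

Lemma rad_composite_cat i j X Y Z (f : {linear X -> Y}) (g : {linear Y -> Z}) :
  C Y -> rad_composite C i f -> rad_composite C j g ->
  rad_composite C (i + j) (g \o f : {linear X -> Z}).
Proof.
move=> CY; elim: i X f => [|[|i] IH] X f cf cg; first exact: rad_composite_compr.
  case: j cg {IH} => [|j] cg; first exact: rad_compl.
  by exists Y, f, g; split.
have [W [h [k [CW rh ck fE]]]] := cf.
exists W, h, (g \o k : {linear W -> Z}); split=> //; first exact: (IH _ k).
by move=> x; rewrite /= fE.
Qed.

Lemma rad_compositeW i X Y (f : {linear X -> Y}) :
  rad_composite C i.+1 f -> rad_composite C i f.
Proof.
elim: i X f => [//|[|i] IH] X f [W [h [k [CW rh ck fE]]]].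
  have -> : f = (k \o h : {linear X -> Y}) by exact: linear_eq.
  exact: rad_compl.
by exists W, h, k; split=> //; apply: IH.
Qed.

Lemma rad_composite_le i j X Y (f : {linear X -> Y}) :
  (i <= j)%N -> rad_composite C j f -> rad_composite C i f.
Proof.
elim: j => [|j IH]; first by rewrite leqn0 => /eqP->.
by rewrite leq_eqVlt ltnS => /orP[/eqP->//|ij] /rad_compositeW /IH; apply.
Qed.

Lemma rad_composite_rad i X Y (f : {linear X -> Y}) :
  (0 < i)%N -> rad_composite C i f -> rad f.
Proof. by move=> i0 /(rad_composite_le i0). Qed.

Lemma rad_composite_split i j X Y (f : {linear X -> Y}) :
  (0 < i)%N -> (0 < j)%N -> rad_composite C (i + j) f ->
  exists Z (h : {linear X -> Z}) (k : {linear Z -> Y}),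
    [/\ C Z, rad_composite C i h, rad_composite C j k & f = (k \o h : {linear X -> Y})].
Proof.
case: i => // i _ j0; elim: i X f => [|i IH] X f.
  case: j j0 => // j _ [W [h [k [CW rh ck fE]]]].
  by exists W, h, k; split=> //; apply: linear_eq.
move=> [W [h [k [CW rh ck fE]]]].
have [Z [h' [k' [CZ ch ck' kE]]]] := IH _ _ ck.
exists Z, (h' \o h : {linear X -> Z}), k'; split=> //.
  exact: (rad_composite_cat (i := 1)).
by apply: linear_eq => x; rewrite fE kE.
Qed.

Lemma rad_pow_ind i X Y (P : {linear X -> Y} -> Prop) :
  P \0 -> (forall f g, P f -> P g -> P (f \+ g : {linear X -> Y})) ->
  (forall f, rad_composite C i f -> P f) -> forall f, rad_pow C i f -> P f.
Proof.
move=> P0 PD PC f [n [g [gC fE]]]; elim: n g gC f fE => [|n IH] g gC f fE.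
  by rewrite (_ : f = \0)//; apply: linear_eq => x; rewrite fE big_ord0.
have fL : linear (fun x => \sum_(j < n) g (lift ord0 j) x).
  move=> a x y; rewrite scaler_sumr -big_split/=; apply: eq_bigr => j _.
  by rewrite linearP.
rewrite (_ : f = (g ord0 \+ mklin fL : {linear X -> Y})).
  by apply: PD; [exact: PC|apply: (IH (fun j => g (lift ord0 j)))].
by apply: linear_eq => x; rewrite fE big_ord_recl.
Qed.

Lemma rad_composite_pow i X Y (f : {linear X -> Y}) :
  rad_composite C i f -> rad_pow C i f.
Proof.
by move=> cf; exists 1%N, (fun=> f); split=> // x; rewrite big_ord1.
Qed.

Lemma rad_pow0 i X Y : rad_pow C i (\0 : {linear X -> Y}).
Proof. by exists 0%N, (fun=> \0); split=> [[]//|x]; rewrite big_ord0. Qed.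

Lemma rad_powD i X Y (f g : {linear X -> Y}) : rad_pow C i f -> rad_pow C i g ->
  rad_pow C i (f \+ g : {linear X -> Y}).
Proof.
move=> [n [f' [fC fE]]] [m [g' [gC gE]]].
exists (n + m)%N, (fun j => match split j with inl a => f' a | inr b => g' b end).
split=> [j|x]; first by case: split.
rewrite big_split_ord/= fE gE; congr (_ + _); apply: eq_bigr => j _.
  by rewrite (unsplitK (inl j)).
by rewrite (unsplitK (inr j)).
Qed.

Lemma rad_pow_compr i X Y Z (f : {linear Y -> Z}) (u : {linear X -> Y}) :
  rad_pow C i f -> rad_pow C i (f \o u : {linear X -> Z}).
Proof.
move=> [n [f' [fC fE]]]; exists n, (fun j => f' j \o u : {linear X -> Z}).
by split=> [j|x]; [exact: rad_composite_compr|exact: fE].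
Qed.

Lemma rad_pow_compl i X Y Z (f : {linear X -> Y}) (u : {linear Y -> Z}) :
  rad_pow C i f -> rad_pow C i (u \o f : {linear X -> Z}).
Proof.
move=> [n [f' [fC fE]]]; exists n, (fun j => u \o f' j : {linear X -> Z}).
by split=> [j|x]; [exact: rad_composite_compl|rewrite /= fE linear_sum].
Qed.

Lemma rad_pow_sum i X Y n (g : 'I_n -> {linear X -> Y}) (f : {linear X -> Y}) :
  (forall j, rad_pow C i (g j)) -> (forall x, f x = \sum_j g j x) -> rad_pow C i f.
Proof.
elim: n g f => [|n IH] g f gr fE.
  by rewrite (_ : f = \0); [exact: rad_pow0|apply: linear_eq => x; rewrite fE big_ord0].
have fL : linear (fun x => \sum_(j < n) g (lift ord0 j) x).
  move=> a x y; rewrite scaler_sumr -big_split/=; apply: eq_bigr => j _.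
  by rewrite linearP.
rewrite (_ : f = (g ord0 \+ mklin fL : {linear X -> Y})).
  by apply: rad_powD => //; apply: (IH (fun j => g (lift ord0 j))).
by apply: linear_eq => x; rewrite fE big_ord_recl.
Qed.

Lemma rad_pow_le i j X Y (f : {linear X -> Y}) :
  (i <= j)%N -> rad_pow C j f -> rad_pow C i f.
Proof.
move=> ij [n [g [gC fE]]]; exists n, g; split=> // k; exact: rad_composite_le (gC k).
Qed.

Lemma rad_pow_rad i X Y (f : {linear X -> Y}) : (0 < i)%N -> rad_pow C i f -> rad f.
Proof.
move=> i0; apply: rad_pow_ind; [exact: rad0|exact: radD|].
by move=> g; apply: rad_composite_rad.
Qed.

Lemma rad_pow_cat i j X Y Z (f : {linear X -> Y}) (g : {linear Y -> Z}) :
  C Y -> rad_pow C i f -> rad_pow C j g -> rad_pow C (i + j) (g \o f : {linear X -> Z}).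
Proof.
move=> CY fr gr; move: f fr; apply: rad_pow_ind => [|f f' Pf Pf'|f cf].
- rewrite (_ : (_ \o _ : {linear X -> Z}) = \0); first exact: rad_pow0.
  by apply: linear_eq => x /=; rewrite linear0.
- rewrite (_ : (_ \o _ : {linear X -> Z}) =
    ((g \o f : {linear X -> Z}) \+ (g \o f' : {linear X -> Z}) : {linear X -> Z})).
    exact: rad_powD.
  by apply: linear_eq => x /=; rewrite linearD.
- move: g gr; apply: rad_pow_ind => [|g g' Pg Pg'|g cg].
  + by rewrite (_ : (_ \o _ : {linear X -> Z}) = \0); [exact: rad_pow0|exact: linear_eq].
  + rewrite (_ : (_ \o _ : {linear X -> Z}) =
      ((g \o f : {linear X -> Z}) \+ (g' \o f : {linear X -> Z}) : {linear X -> Z})).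
      exact: rad_powD.
    exact: linear_eq.
  + exact/rad_composite_pow/rad_composite_cat.
Qed.

Hypothesis Csum : closed_summands C.
Hypothesis Cflen : forall X, C X -> flenT X.

(* A direct sum decomposition, recorded only through the decomposition of the
   identity that it induces. *)
Lemma ind_decomposition X : C X ->
  exists n (F : 'I_n -> lmodType A) (p : forall i, {linear X -> F i})
    (q : forall i, {linear F i -> X}),
    (forall i, ind C (F i)) /\ forall x, x = \sum_i q i (p i x).
Proof.
move=> CX; have [n nX] := Cflen CX.
elim: n X CX nX => [|n IH] X CX nX; first by case: nX.
have [X0|X0] := pselect (is_zero X).
  exists 0%N, (fun=> X), (fun=> idfun), (fun=> idfun); split=> [[]//|x].
  by rewrite big_ord0; exact: X0.
have [iX|] := pselect (indecomposable X).
  exists 1%N, (fun=> X), (fun=> idfun), (fun=> idfun); split=> [//|x].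
  by rewrite big_ord1.
move=> /not_andP[//|/existsNP[Y /existsNP[Z /not_implyP[XYZ /not_orP[Y0 Z0]]]]].
have XZY : isomorphic X (Z * Y)%type.
  apply: isomorphic_trans XYZ _.
  have sL (U V : lmodType A) : linear (fun p : U * V => (p.2, p.1)).
    by move=> a x y.
  by exists (mklin (sL _ _)); exists (mklin (sL _ _)); split=> -[].
have CY := Csum XYZ CX; have CZ := Csum XZY CX.
(* U is embedded as a proper submodule of X because V is non-zero, so its chains are shorter by at
   least one step. *)
have small (U V : lmodType A) : isomorphic X (U * V)%type -> ~ is_zero V ->
    ~ chain n (fun _ : U => True).
  move=> /isomorphic_sym[f fI] /existsNP[v v0] cU; apply: nX.
  have iL : linear (fun u : U => (u, 0 : V)).
    by move=> a x y; apply: injective_projections; rewrite //= scaler0 addr0.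
  pose g := (f \o mklin iL : {linear U -> X}).
  have gI : injective g by move=> x y /(iso_inj fI) [].
  exists (fun x => exists2 u, True & x = g u); split=> //.
  - exact: submod_image.
  - exists (f (0, v)) => // -[u _ /(iso_inj fI)[_ /v0]].
    by [].
  - exact: (chain_image gI cU).
have [n1 [F1 [p1 [q1 [F1P E1]]]]] := IH _ CY (small _ _ XYZ Z0).
have [n2 [F2 [p2 [q2 [F2P E2]]]]] := IH _ CZ (small _ _ XZY Y0).
have [f [g [fK gK]]] := XYZ.
(* Everything is defined by matching on the sum type, so that the types of the maps reduce together
   with the type of the summand. *)
pose G s := match s with inl a => F1 a | inr b => F2 b end.
pose F := fun j : 'I_(n1 + n2) => G (split j).
pose fst' : {linear (Y * Z)%type -> Y} := fst.
pose snd' : {linear (Y * Z)%type -> Z} := snd.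
have i1L : linear (fun u : Y => (u, 0 : Z)).
  by move=> a x y; apply: injective_projections; rewrite //= scaler0 addr0.
have i2L : linear (fun u : Z => (0 : Y, u)).
  by move=> a x y; apply: injective_projections; rewrite //= scaler0 addr0.
pose P s : {linear X -> G s} :=
  match s return {linear X -> G s} with
  | inl a => p1 a \o (fst' \o f)
  | inr b => p2 b \o (snd' \o f)
  end.
pose Q s : {linear G s -> X} :=
  match s return {linear G s -> X} with
  | inl a => (g \o mklin i1L) \o q1 a
  | inr b => (g \o mklin i2L) \o q2 b
  end.
pose p j : {linear X -> F j} := P (split j).
pose q j : {linear F j -> X} := Q (split j).
exists (n1 + n2)%N, F, p, q; split=> [j|x].
  by rewrite /F; case: split => k /=.
have qpl a : q (lshift n2 a) (p (lshift n2 a) x) = g (mklin i1L (q1 a (p1 a (f x).1))).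
  by rewrite /q /p /F (unsplitK (inl a)).
have qpr b : q (rshift n1 b) (p (rshift n1 b) x) = g (mklin i2L (q2 b (p2 b (f x).2))).
  by rewrite /q /p /F (unsplitK (inr b)).
rewrite big_split_ord/= (eq_bigr _ (fun a _ => qpl a)) (eq_bigr _ (fun a _ => qpr a)).
rewrite -!linear_sum -E1 -E2 -linearD -[LHS]fK; congr (g _).
by apply: injective_projections; rewrite /= ?addr0 ?add0r.
Qed.

End RadPow.

(** * Finite type implies nilpotency of the radical *)

Section HomSets.
Variables (R : comNzRingType) (L : algType R).
Implicit Types X Y Z : lmodType L.

Fact central_linear X (r : R) : linear (fun x : X => (r *: (x : restr X)) : X).
Proof.
by move=> a x y; rewrite restr_scaleC -scalerDr.
Qed.

Definition central X (r : R) : {linear X -> X} := mklin (central_linear r).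

(* The scalars of R act on Hom(X, Z) through the centre of L. *)
Definition hom_submod X Z (P : {linear X -> Z} -> Prop) : Prop :=
  [/\ P \0, forall f g, P f -> P g -> P (f \+ g : {linear X -> Z})
    & forall r f, P f -> P (central Z r \o f : {linear X -> Z})].

Lemma hom_submod_rad_pow (C : lmodType L -> Prop) i X Z :
  hom_submod (@rad_pow L C i X Z).
Proof. by split=> *; [exact: rad_pow0|exact: rad_powD|exact: rad_pow_compl]. Qed.

Lemma submod_orbit X Z (P : {linear X -> Z} -> Prop) (x : X) : hom_submod P ->
  submod (fun z : restr Z => exists2 f, P f & z = f x).
Proof.
move=> [P0 PD PZ]; split; first by exists \0.
move=> r _ _ [f Pf ->] [g Pg ->].
by exists ((central Z r \o f : {linear X -> Z}) \+ g : {linear X -> Z}); first exact/PD/Pg/PZ.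
Qed.

(** Evaluation at k generators of X embeds Hom(X, Z) in Z^k, which has finite length over R. *)
Lemma hom_dcc X Z (P : nat -> {linear X -> Z} -> Prop) :
  fin_gen X -> flenT (restr Z) -> (forall n, hom_submod (P n)) ->
  (forall n f, P n.+1 f -> P n f) ->
  exists n, forall m, (n <= m)%N -> forall f, P n f -> P m f.
Proof.
move=> [k [g gX]] fZ sP decP.
have [|||n nP] := @flen_dcc R {ffun 'I_k -> restr Z}
  (fun n phi => exists2 f, P n f & forall i, phi i = f (g i)).
- exact/flen_all/flen_ffun.
- move=> n; have [P0 PD PZ] := sP n; split; first by exists \0 => // i; rewrite ffunE.
  move=> r phi psi [f Pf fE] [f' Pf' fE'].
  exists ((central Z r \o f : {linear X -> Z}) \+ f' : {linear X -> Z}).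
    exact/PD/Pf'/PZ.
  by move=> i; rewrite !ffunE fE fE'.
- by move=> n phi [f /decP Pf fE]; exists f.
exists n => m nm f Pf.
have [|f' Pf' fE] := nP m nm [ffun i => f (g i)].
  by exists f => // i; rewrite ffunE.
rewrite (_ : f = f')//; apply: linear_eq => x; have [c ->] := gX x.
rewrite !linear_for_sum; apply: eq_bigr => i _; congr (_ *: _).
by rewrite -fE ffunE.
Qed.

(* A nonzero x whose orbit under End(X) is minimal is killed by every
   non-isomorphism. *)
Lemma ind_socle X : indecomposable X -> flenT (restr X) ->
  exists2 x : X, x <> 0 & forall u : {linear X -> X}, ~ isomorphism u -> u x = 0.
Proof.
move=> iX fX; have fX' : flenT X by exact: flen_restr.
pose orb (x z : restr X) := exists2 u : {linear X -> X}, True & z = u x.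
have sorb x : submod (orb x) by apply: submod_orbit.
have [x x0] : exists x : X, x <> 0 by apply/existsNP; case: iX.
have orbT y : exists x', forall z, orb y z <-> orb x' z by exists y.
have [|T [sT [y y0 Ty] _ minT]] := @flen_min R (restr X)
  (fun T => exists2 x : X, x <> 0 & forall z, T z <-> orb x z) _ (flen_all _ fX) (sorb x).
  by exists x.
exists y => // u nu; apply: contrapT => uy.
have [|||v _ yE] := minT _ (sorb (u y)) _ _ y.
- by exists (u y).
- move=> _ [v _ ->]; apply/Ty; by exists (v \o u : {linear X -> X}).
- by apply/Ty; exists idfun.
(* Here y = v (u y). If v u is an isomorphism, u is injective and so an isomorphism; otherwise 1 - v
   u is injective and kills y. *)
have [[w [wK wK']]|/iso_inj vu] := ind_local fX' (v \o u : {linear X -> X}) iX.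
  apply: nu; apply: inj_iso => // a b ab; apply: (can_inj wK).
  by rewrite /= ab.
by apply: y0; apply: vu; rewrite linear0 /= -yE subrr.
Qed.

End HomSets.

Section FiniteType.
Variables (R : comNzRingType) (L : algType R) (C : lmodType L -> Prop).
Hypothesis artL : artin_algebra L.
Hypothesis Cfg : subcategory_of_mod C.
Hypothesis Cadd : additive_subcategory C.
Hypothesis Csum : closed_summands C.
Hypothesis Cex : exists X, C X.

Lemma C_flen_restr X : C X -> flenT (restr X).
Proof. by move=> /Cfg; apply: fin_gen_flen. Qed.

Lemma C_flen X : C X -> flenT X.
Proof. by move=> /C_flen_restr; apply: flen_restr. Qed.

Lemma additive_generator : finite_rep_type C -> exists2 M, C M &
  forall X, C X -> exists n (p : 'I_n -> {linear X -> M}) (q : 'I_n -> {linear M -> X}),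
    forall x, x = \sum_i q i (p i x).
Proof.
move=> [n [F [iF Ffin]]].
have [M CM MF] : exists2 M, C M & forall i, exists (p : {linear F i -> M})
    (q : {linear M -> F i}), cancel p q.
  elim: n F iF {Ffin} => [|n IH] F iF.
    (* The product starts from an arbitrary object of C; the additional summand does no harm. *)
    by have [X CX] := Cex; exists X => // -[].
  have [M CM MF] := IH (fun i => F (lift ord0 i)) (fun i => iF _).
  have i1L : linear (fun u : F ord0 => (u, 0 : M)).
    by move=> a x y; apply: injective_projections; rewrite //= scaler0 addr0.
  have i2L : linear (fun u : M => (0 : F ord0, u)).
    by move=> a x y; apply: injective_projections; rewrite //= scaler0 addr0.
  exists (F ord0 * M)%type; first by apply: Cadd.2 => //; case: (iF ord0).
  move=> i; case: (unliftP ord0 i) => [j ->|->].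
    have [p [q pK]] := MF j.
    exists (mklin i2L \o p : {linear _ -> (F ord0 * M)%type}).
    by exists (q \o snd : {linear (F ord0 * M)%type -> _}) => x /=; rewrite pK.
  exists (mklin i1L : {linear _ -> (F ord0 * M)%type}).
  by exists (fst : {linear (F ord0 * M)%type -> _}).
exists M => // X CX.
have [m [G [p [q [iG E]]]]] := ind_decomposition Csum C_flen CX.
have GM i : exists pq : {linear G i -> M} * {linear M -> G i}, cancel pq.1 pq.2.
  have [j [f [g [fK _]]]] := Ffin _ (iG i); have [p' [q' pK]] := MF j.
  exists (p' \o f : {linear _ -> _}, g \o q' : {linear _ -> _}) => x /=.
  by rewrite pK fK.
(* The type of the pair depends on [i], hence [cid] at each index. *)
pose pq i := projT1 (cid (GM i)); have pqK i : cancel (pq i).1 (pq i).2 := projT2 (cid (GM i)).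
exists m, (fun i => (pq i).1 \o p i : {linear _ -> _}), (fun i => q i \o (pq i).2 : {linear _ -> _}).
by move=> x; rewrite [LHS]E; apply: eq_bigr => i _ /=; rewrite pqK.
Qed.

(* For an additive generator M the powers rad^i(M, M) stabilise at some B with
   B = BB; a minimal nonzero B x then contains y = b y with b radical. *)
Lemma finite_type_rad_nilpotent : finite_rep_type C ->
  exists2 t, (1 <= t)%N & forall (X Y : lmodType L) (f : {linear X -> Y}), C X -> C Y ->
    rad_pow C t f -> f =1 \0.
Proof.
move=> /additive_generator[M CM MC].
have [n nB] := hom_dcc (P := fun n => @rad_pow L C n M M) (Cfg CM) (C_flen_restr CM)
  (fun n => hom_submod_rad_pow C n M M)
  (fun n f => rad_pow_le (leqnSn n)).
(* The shift makes t positive, so that maps in B are radical and composites of t + t maps can be cut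
   in the middle. *)
pose t := n.+1; pose B := @rad_pow L C t M M.
have BB f : B f -> exists m (g h : 'I_m -> {linear M -> M}),
    [/\ forall i, B (g i), forall i, B (h i) & forall x, f x = \sum_i g i (h i x)].
  move=> Bf; have : rad_pow C (t + t) f.
    apply: nB; first by rewrite (leq_trans (leqnSn n))// leq_addr.
    exact: rad_pow_le (leqnSn n) Bf.
  apply: (rad_pow_ind (P := fun f : {linear M -> M} => exists m (g h : 'I_m -> {linear M -> M}),
    [/\ forall i, B (g i), forall i, B (h i) & forall x, f x = \sum_i g i (h i x)])).
  - by exists 0%N, (fun=> idfun), (fun=> idfun); split=> [[]//|[]//|x]; rewrite big_ord0.
  - move=> f1 f2 [m1 [g1 [h1 [Bg1 Bh1 E1]]]] [m2 [g2 [h2 [Bg2 Bh2 E2]]]].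
    exists (m1 + m2)%N, (fun j => match split j with inl a => g1 a | inr b => g2 b end),
      (fun j => match split j with inl a => h1 a | inr b => h2 b end).
    split=> [j|j|x]; [by case: split|by case: split|].
    rewrite big_split_ord/= E1 E2; congr (_ + _); apply: eq_bigr => j _.
      by rewrite (unsplitK (inl j)).
    by rewrite (unsplitK (inr j)).
  (* The middle object Z is not M in general; its identity is a sum of maps through M, which turns
     the composite into a sum of products of elements of B. *)
  - move=> g /(rad_composite_split (ltn0Sn n) (ltn0Sn n))[Z [h [k [CZ ch ck ->]]]].
    have [m [p [q E]]] := MC Z CZ.
    exists m, (fun i => k \o q i : {linear _ -> _}), (fun i => p i \o h : {linear _ -> _}).
    split=> [i|i|x].
    + exact/rad_pow_compr/rad_composite_pow.
    + exact/rad_pow_compl/rad_composite_pow.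
    + by rewrite /= {1}(E (h x)) linear_sum.
have B0 f : B f -> forall x, f x = 0.
  move=> Bf x; apply: contrapT => fx.
  have sB : hom_submod B by exact: hom_submod_rad_pow.
  pose orb (x z : restr M) := exists2 f : {linear M -> M}, B f & z = f x.
  pose nz (x : M) := exists2 f, B f & f x <> 0.
  have [|T [sT [y [g Bg gy] Ty] _ minT]] := @flen_min R (restr M)
    (fun T => exists2 x : M, nz x & forall z, T z <-> orb x z) _
    (flen_all _ (C_flen_restr CM)) (submod_orbit x sB).
    by exists x => //; exists f.
  have [m [g1 [g2 [Bg1 Bg2 E]]]] := BB _ Bg.
  have [i gi] : exists i, g1 i (g2 i y) <> 0.
    apply: contrapT => /forallNP g0; apply: gy; rewrite E big1// => i _.
    exact: contrapT (g0 i).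
  (* The orbit of z = [g2 i y] is non-zero and lies in the minimal orbit of y, to which z itself
     belongs. Hence z = g' z with g' in B. *)
  have [|||g' Bg' yE] := minT _ (submod_orbit (g2 i y) sB) _ _ (g2 i y).
  - by exists (g2 i y) => //; exists (g1 i).
  - move=> _ [h Bh ->]; apply/Ty; exists (h \o g2 i : {linear _ -> _}) => //.
    exact: (rad_pow_compl h (Bg2 i)).
  - by apply/Ty; exists (g2 i).
  apply: gi; have rg' : rad g' by apply: rad_pow_rad Bg'.
  have := rad_fixed (g := idfun) rg' yE; rewrite /= => ->; exact: linear0.
exists t => // X Y f CX CY ft x.
have [m [p [q E]]] := MC X CX; have [m' [p' [q' E']]] := MC Y CY.
rewrite [LHS]E' big1// => j _; rewrite (E x) !linear_sum big1// => i _.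
rewrite (_ : p' j _ = 0) ?linear0//.
pose b := p' j \o (f \o q i) : {linear M -> M}.
by apply: (B0 b); apply: rad_pow_compl; apply: rad_pow_compr.
Qed.

End FiniteType.

(** * Almost split morphisms and finiteness *)

Section Bounded.
Variables (R : comNzRingType) (L : algType R) (C : lmodType L -> Prop).
Hypothesis artL : artin_algebra L.
Hypothesis Cfg : subcategory_of_mod C.
Hypothesis Csum : closed_summands C.
Implicit Types X Y Z W : lmodType L.

(** The family has to cover the indecomposables satisfying Q but not to satisfy Q itself, so the
    notion passes to smaller Q. *)
Definition fin_class (Q : lmodType L -> Prop) : Prop :=
  exists (n : nat) (F : 'I_n -> lmodType L),
    (forall i, ind C (F i)) /\
    forall X, ind C X -> Q X -> exists i, isomorphic X (F i).

Lemma fin_class_sub (P Q : lmodType L -> Prop) :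
  (forall X, ind C X -> P X -> Q X) -> fin_class Q -> fin_class P.
Proof.
move=> PQ [n [F [FP FQ]]]; exists n, F; split=> // X iX PX.
by apply: FQ => //; apply: PQ.
Qed.

Lemma fin_class0 : fin_class (fun=> False).
Proof. by exists 0%N, (fun=> L^o); split=> [[]|]. Qed.

Lemma fin_class1 X : ind C X -> fin_class (fun Y => isomorphic Y X).
Proof. by move=> iX; exists 1%N, (fun=> X); split=> // Y _ YX; exists ord0. Qed.

Lemma fin_classU (P Q : lmodType L -> Prop) : fin_class P -> fin_class Q ->
  fin_class (fun X => P X \/ Q X).
Proof.
move=> [n [F [FP FQ]]] [n' [F' [FP' FQ']]].
exists (n + n')%N, (fun j => match split j with inl a => F a | inr b => F' b end).
split=> [j|X iX [/FQ|/FQ'] [//|i Xi]]; first by case: split.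
  by exists (lshift n' i); rewrite (unsplitK (inl i)).
by exists (rshift n i); rewrite (unsplitK (inr i)).
Qed.

Lemma fin_class_bigU n (Q : 'I_n -> lmodType L -> Prop) :
  (forall i, fin_class (Q i)) -> fin_class (fun X => exists i, Q i X).
Proof.
elim: n Q => [|n IH] Q fQ.
  by apply: fin_class_sub fin_class0 => X _ [[]].
apply: fin_class_sub (fin_classU (fQ ord0) (IH _ (fun i => fQ (lift ord0 i)))).
move=> X _ [i]; case: (unliftP ord0 i) => [j ->|->]; last by left.
by right; exists j.
Qed.

Definition right_almost_split : Prop := forall X, ind C X ->
  exists Z (p : {linear Z -> X}), [/\ C Z, rad p &
    forall Y (h : {linear Y -> X}), C Y -> rad h ->
      exists k : {linear Y -> Z}, h = (p \o k : {linear Y -> X})].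

Definition left_almost_split : Prop := forall X, ind C X ->
  exists Z (q : {linear X -> Z}), [/\ C Z, rad q &
    forall Y (h : {linear X -> Y}), C Y -> rad h ->
      exists k : {linear Z -> Y}, h = (k \o q : {linear X -> Y})].

(* Modulo the summands of X, a map Y -> X factors through the almost split maps
   ending at these summands; iterate t times. *)
Lemma fin_class_to t X : right_almost_split -> C X ->
  fin_class (fun Y => exists f : {linear Y -> X}, ~ rad_pow C t f).
Proof.
move=> ras; elim: t X => [|t IH] X CX.
  by apply: fin_class_sub fin_class0 => Y _ [f []]; exact: rad_composite_pow.
have [n [F [p [q [iF E]]]]] := ind_decomposition Csum (C_flen artL Cfg) CX.
have clF i : fin_class (fun Y => isomorphic Y (F i) \/
    exists f : {linear Y -> F i}, ~ rad_pow C t.+1 f).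
  have [Z [pi [CZ rpi piP]]] := ras _ (iF i).
  apply: fin_class_sub (fin_classU (fin_class1 (iF i)) (IH Z CZ)) => Y [CY iY].
  have [YF|YF] := pselect (isomorphic Y (F i)); first by left.
  case=> [//|[f nf]]; right; apply: contrapT => /forallNP allk; apply: nf.
  (* Y and F i are non-isomorphic indecomposables, so f does not split. *)
  have rf : rad f.
    have [CFi iFi] := iF i; apply: rad_not_split_epi => //.
      exact: (C_flen artL Cfg CFi).
    move=> [s fs]; apply: YF; apply: (split_ind_isomorphic (h := f) (s := s)) => //.
      exact: (C_flen artL Cfg CY).
    by case: iFi.
  have [k ->] := piP _ _ CY rf.
  rewrite -addn1; apply: rad_pow_cat => //; first exact: contrapT (allk k).
  exact: rad_composite_pow.
apply: fin_class_sub (fin_class_bigU clF) => Y iY [f nf].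
apply: contrapT => /forallNP nF; apply: nf.
apply: (rad_pow_sum (g := fun i => (q i \o (p i \o f)) : {linear Y -> X})) => [i|x].
  have /not_orP[_ /forallNP/(_ (p i \o f : {linear Y -> F i}))/contrapT] := nF i.
  exact: rad_pow_compl.
exact: E.
Qed.

(** The dual argument: modulo the summands of X, a map out of X factors through the left almost
    split maps starting at these summands. *)
Lemma fin_class_from t X : left_almost_split -> C X ->
  fin_class (fun Y => exists f : {linear X -> Y}, ~ rad_pow C t f).
Proof.
move=> las; elim: t X => [|t IH] X CX.
  by apply: fin_class_sub fin_class0 => Y _ [f []]; exact: rad_composite_pow.
have [n [F [p [q [iF E]]]]] := ind_decomposition Csum (C_flen artL Cfg) CX.
have clF i : fin_class (fun Y => isomorphic Y (F i) \/
    exists f : {linear F i -> Y}, ~ rad_pow C t.+1 f).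
  have [Z [pi [CZ rpi piP]]] := las _ (iF i).
  apply: fin_class_sub (fin_classU (fin_class1 (iF i)) (IH Z CZ)) => Y [CY iY].
  have [YF|YF] := pselect (isomorphic Y (F i)); first by left.
  case=> [//|[f nf]]; right; apply: contrapT => /forallNP allk; apply: nf.
  have rf : rad f.
    have [CFi iFi] := iF i; apply: rad_not_split_mono => //.
      exact: (C_flen artL Cfg CFi).
    move=> [r rf]; apply: YF; apply: (split_ind_isomorphic (h := r) (s := f)) => //.
      exact: (C_flen artL Cfg CY).
    by case: iFi.
  have [k ->] := piP _ _ CY rf.
  rewrite -add1n; apply: rad_pow_cat => //; last exact: contrapT (allk k).
  exact: rad_composite_pow.
apply: fin_class_sub (fin_class_bigU clF) => Y iY [f nf].
apply: contrapT => /forallNP nF; apply: nf.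
apply: (rad_pow_sum (g := fun i => ((f \o q i) \o p i) : {linear X -> Y})) => [i|x].
  have /not_orP[_ /forallNP/(_ (f \o q i : {linear F i -> Y}))/contrapT] := nF i.
  exact: rad_pow_compr.
by rewrite {1}(E x) linear_sum.
Qed.

Lemma finite_of_rad_pow_to_zero W : right_almost_split -> C W ->
  (forall Y, ind C Y -> exists f : {linear Y -> W}, ~ f =1 \0) ->
  (forall X, ind C X -> exists2 t : nat, (1 <= t)%N & rad_pow_to_zero C t X) ->
  finite_rep_type C.
Proof.
move=> ras CW YW bnd.
have [n [F [p [q [iF E]]]]] := ind_decomposition Csum (C_flen artL Cfg) CW.
have /choice[t tP] i : exists t, rad_pow_to_zero C t (F i).
  by have [t _ tP] := bnd _ (iF i); exists t.
(* The bounds concern indecomposables whereas W is a sum of them, so the largest exponent over the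
   summands is taken. *)
have [m [G [iG GP]]] := fin_class_to (\max_i t i) ras CW.
exists m, G; split=> // Y iY; apply: GP => //.
have [f f0] := YW Y iY; exists f => fr; apply: f0 => y.
rewrite [LHS]E big1// => i _; rewrite (_ : p i (f y) = 0) ?linear0//.
apply: (tP i _ (p i \o f : {linear Y -> F i})); first by case: iY.
by apply: rad_pow_compl; apply: rad_pow_le fr; apply: leq_bigmax.
Qed.

Lemma finite_of_rad_pow_from_zero W : left_almost_split -> C W ->
  (forall Y, ind C Y -> exists f : {linear W -> Y}, ~ f =1 \0) ->
  (forall X, ind C X -> exists2 t : nat, (1 <= t)%N & rad_pow_from_zero C t X) ->
  finite_rep_type C.
Proof.
move=> las CW WY bnd.
have [n [F [p [q [iF E]]]]] := ind_decomposition Csum (C_flen artL Cfg) CW.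
have /choice[t tP] i : exists t, rad_pow_from_zero C t (F i).
  by have [t _ tP] := bnd _ (iF i); exists t.
have [m [G [iG GP]]] := fin_class_from (\max_i t i) las CW.
exists m, G; split=> // Y iY; apply: GP => //.
have [f f0] := WY Y iY; exists f => fr; apply: f0 => w.
rewrite [in LHS](E w) linear_sum big1// => i _.
apply: (tP i _ (f \o q i : {linear F i -> Y})); first by case: iY.
by apply: rad_pow_compr; apply: rad_pow_le fr; apply: leq_bigmax.
Qed.

(** The powers become constant by [hom_dcc], and the stable value lies in every power. The exponent
    is n + 1 so as to be positive. *)
Lemma rad_pow_stable X Z : C X -> C Z -> rad_infty_zero C ->
  exists2 t, (1 <= t)%N & forall f : {linear X -> Z}, rad_pow C t f -> f =1 \0.
Proof.
move=> CX CZ r0.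
have [n nP] := hom_dcc (P := fun n => @rad_pow L C n X Z) (Cfg CX)
  (C_flen_restr artL Cfg CZ) (fun n => hom_submod_rad_pow C n X Z)
  (fun n f => rad_pow_le (leqnSn n)).
exists n.+1 => // f /(rad_pow_le (leqnSn n)) fn; apply: r0 => // i _.
by have [/nP/(_ f fn)//|/ltnW in_] := leqP n i; exact: rad_pow_le fn.
Qed.

Lemma rad_pow_to_zero_of_infty X : C L^o -> C X -> rad_infty_zero C ->
  exists2 t, (1 <= t)%N & rad_pow_to_zero C t X.
Proof.
move=> CL CX r0; have [t t1 tP] := rad_pow_stable CL CX r0.
exists t => // Y f CY ft y.
have gL : linear (fun a : L^o => a *: y) by move=> a b c; rewrite scalerDl scalerA.
have := tP (f \o mklin gL : {linear L^o -> X}) (rad_pow_compr _ ft) 1.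
by rewrite /= scale1r.
Qed.

Lemma rad_pow_from_zero_of_infty W X : C W ->
  (forall Y (y : Y), C Y -> y <> 0 -> exists g : {linear Y -> W}, g y <> 0) ->
  C X -> rad_infty_zero C -> exists2 t, (1 <= t)%N & rad_pow_from_zero C t X.
Proof.
move=> CW cog CX r0; have [t t1 tP] := rad_pow_stable CX CW r0.
exists t => // Y f CY ft x; apply: contrapT => fx.
have [g] := cog _ _ CY fx; apply.
exact: (tP (g \o f : {linear X -> W}) (rad_pow_compl _ ft)).
Qed.

End Bounded.

(** * Injectivity and reflexivity *)

Section Cogenerators.
Variable R : comNzRingType.

(** The propositional form of [maximal_ideal], to which the extremal principles [flen_min] and
    [flen_max] apply. *)
Definition max_ideal (m : R^o -> Prop) : Prop :=
  [/\ submod m, ~ m 1 & forall n : R^o -> Prop, submod n ->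
    (forall r, m r -> n r) -> ~ n 1 -> forall r, n r -> m r].

Lemma max_ideal_ex (a : R^o -> Prop) : flenT (R^o : lmodType R) -> submod a -> ~ a 1 ->
  exists2 m, max_ideal m & forall r, a r -> m r.
Proof.
move=> fR sa a1.
have [m [sm m1 am maxm]] := flen_max (P := fun m => ~ m 1) fR sa a1.
by exists m => //; split=> // n sn mn n1; apply: maxm.
Qed.

Lemma submod_colon (V : lmodType R) (S : V -> Prop) (y : V) : submod S ->
  submod (fun r : R^o => S (r *: y)).
Proof.
move=> [S0 SD]; split; first by rewrite scale0r.
by move=> a b c Sb Sc; rewrite scalerDl -scalerA; apply: SD.
Qed.

Variable I : lmodType R.

(* Injectivity relative to modules of finite length; a partial linear map
   W -> I is given by its graph. *)
Definition graph_injective : Prop :=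
  forall (W : lmodType R), flenT W -> forall G : (W * I)%type -> Prop, submod G ->
    (forall v, G (0, v) -> v = 0) ->
    exists phi : {linear W -> I}, forall w v, G (w, v) -> phi w = v.

(** Every simple module R / m embeds in I. *)
Definition meets_simples : Prop :=
  forall m, max_ideal m -> exists2 w : I, w <> 0 & forall a, m a -> a *: w = 0.

(** Each R / m occurs exactly once in the socle of I, so that the double dual of a simple module is
    no larger than the module. *)
Definition socle_multiplicity_one : Prop :=
  forall m, max_ideal m -> exists w : I, [/\ w <> 0, forall a, m a -> a *: w = 0 &
    forall v, (forall a, m a -> a *: v = 0) -> exists r, v = r *: w].

Hypothesis fR : flenT (R^o : lmodType R).
Hypothesis Iinj : graph_injective.

Lemma submod_socle_mult_simples : socle_multiplicity_one -> meets_simples.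
Proof. by move=> sI m /sI[w [w0 mw _]]; exists w. Qed.

(** The hypothesis makes s + r y |-> r w well defined on S + R y; injectivity extends it to W. *)
Lemma extend_cyclic (W : lmodType R) (S : W -> Prop) (y : W) (w : I) :
  flenT W -> submod S -> (forall r, S (r *: y) -> r *: w = 0) ->
  exists phi : {linear W -> I}, (forall s, S s -> phi s = 0) /\ phi y = w.
Proof.
move=> fW sS Sw.
have [||phi phiP] := Iinj (G := fun p => exists s r, [/\ S s, p.1 = s + r *: y & p.2 = r *: w]) fW.
- split; first by exists 0, 0; rewrite !scale0r addr0; split=> //; apply: submod0.
  move=> a [w1 v1] [w2 v2] /= [s [r [Ss -> ->]]] [s' [r' [Ss' -> ->]]].
  exists (a *: s + s'), (a * r + r'); split; first by case: sS => _; apply.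
    by rewrite scalerDr addrACA !scalerDl !scalerA.
  by rewrite scalerDl scalerA.
- move=> v [s [r [Ss /= + ->]]] => /esym/eqP; rewrite addrC addr_eq0 => /eqP ry.
  by apply: Sw; rewrite ry; apply: submodN.
exists phi; split=> [s Ss|]; apply: phiP => /=.
  by exists s, 0; rewrite !scale0r addr0.
by exists 0, 1; rewrite !scale1r add0r; split=> //; apply: submod0.
Qed.

(** The ideal of all r with r y in S is proper, so it lies in some m, and y can be sent to an
    element of I killed by m. *)
Lemma separate (W : lmodType R) (S : W -> Prop) (y : W) : meets_simples ->
  flenT W -> submod S -> ~ S y ->
  exists phi : {linear W -> I}, (forall s, S s -> phi s = 0) /\ phi y <> 0.
Proof.
move=> Im fW sS Sy.
have [|m mm Sm] := max_ideal_ex fR (submod_colon y sS); first by rewrite scale1r.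
have [w w0 mw] := Im _ mm.
have [|phi [phiS phiy]] := extend_cyclic (y := y) (w := w) fW sS.
  by move=> r /Sm/mw.
by exists phi; rewrite phiy.
Qed.

Lemma separate0 (W : lmodType R) (y : W) : meets_simples -> flenT W -> y <> 0 ->
  exists phi : {linear W -> I}, phi y <> 0.
Proof.
move=> Im fW y0; have [phi [_ phiy]] := separate Im fW (submod_eq0 W) y0.
by exists phi.
Qed.

(* A minimal S such that xi agrees with an evaluation on the functionals
   vanishing on S is zero: otherwise S = S0 + R y with S / S0 simple, and xi
   can be corrected by a multiple of the evaluation at y. *)
Lemma reflexive (W : lmodType R) (xi : {linear W -> I} -> I) :
  socle_multiplicity_one -> flenT W ->
  (forall r (f g h : {linear W -> I}), (forall x, h x = r *: f x + g x) ->
    xi h = r *: xi f + xi g) ->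
  exists x, forall f, xi f = f x.
Proof.
move=> sI fW xiL.
have xi0 : xi \0 = 0.
  have := xiL (-1) \0 \0 \0; rewrite scaleN1r addNr; apply => x.
  by rewrite scaler0 addr0.
have [|S [sS [x xS] _ minS]] := @flen_min R W
  (fun S => exists x, forall f : {linear W -> I}, (forall s, S s -> f s = 0) -> xi f = f x)
  _ (flen_all _ fW) (submodT W).
  (* For S = W only the zero functional is tested. *)
  exists 0 => f f0; rewrite linear0 (_ : f = \0)//.
  by apply: linear_eq => y; exact: f0.
have [S0|nS0] := pselect (forall s, S s -> s = 0).
  by exists x => f; apply: xS => s /S0->; rewrite linear0.
have [|S0 [sS0 [S0S nSS0] _ maxS0]] := @flen_max R W
    (fun U => (forall x, U x -> S x) /\ ~ (forall x, S x -> U x)) _ fW (submod_eq0 W).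
  by split=> // _ ->; apply: submod0.
have [y [Sy S0y]] : exists y, S y /\ ~ S0 y.
  by move/existsNP: nSS0 => [y /not_implyP]; exists y.
have gen r : ~ S0 (r *: y) -> forall s, S s -> exists t b, S0 t /\ s = t + b *: (r *: y).
  move=> nr; have sU := submod_add sS0 (submod_cyclic (r *: y)).
  apply: contrapT => nS; apply: nr; apply: (maxS0 _ sU).
  - split.
      by move=> _ [t [_ [/S0S St [b ->] ->]]]; apply: submodD => //; do 2!apply: submodZ => //.
    move=> SU; apply: nS => s /SU[t [_ [S0t [b ->] ->]]].
    by exists t, b.
  - move=> z S0z; exists z, 0; rewrite addr0; split=> //.
    by exists 0; rewrite scale0r.
  - exists 0, (r *: y); rewrite add0r; split=> //; first exact: submod0.
    by exists 1; rewrite scale1r.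
pose m (r : R^o) := S0 (r *: y).
have mm : max_ideal m.
  split; first exact: submod_colon.
    by rewrite /m scale1r.
  move=> n sn mn n1 r nr; apply: contrapT => /gen/(_ _ Sy)[t [b [S0t yE]]].
  apply: n1; rewrite -(subrK (b * r) 1); apply: (submodD sn); last exact: (submodZ sn b nr).
  by apply: mn; rewrite /m scalerBl scale1r {1}yE -scalerA addrK.
have [w [w0 mw wcyc]] := sI _ mm.
have [f0 [f0S0 f0y]] := extend_cyclic (y := y) (w := w) fW sS0 mw.
have scL r (f : {linear W -> I}) : linear (fun x => r *: f x).
  by move=> a u v; rewrite linearP scalerDr !scalerA mulrC.
have xiZ r f : xi (mklin (scL r f)) = r *: xi f.
  by rewrite (xiL r f \0) ?xi0 ?addr0// => u; rewrite addr0.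
have S0y1 s : S s -> exists t b, S0 t /\ s = t + b *: y.
  by have := gen 1; rewrite scale1r; apply.
(* For a in m the functional a f0 vanishes on S, so xi and the evaluation at x agree on it. The
   defect is thus killed by m, hence equal to r w, and x + r y corrects it. *)
have [|r w1E] := wcyc (xi f0 - f0 x).
  move=> a ma; rewrite scalerBr -xiZ xS/= ?mklinE ?subrr//.
  move=> _ /S0y1[t [b [S0t ->]]].
  by rewrite /= linearD linearZ f0S0// add0r f0y scalerA mulrC -scalerA mw// scaler0.
suff : S0 y by [].
apply: (minS _ sS0) => //; exists (x + r *: y) => f fS0.
(* Since f y is killed by m, it equals c w, and f - c f0 vanishes on all of S. *)
have [a ma|c fy] := wcyc (f y); first by rewrite -linearZ fS0.
have dL : linear (fun x => f x - c *: f0 x).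
  by move=> a u v; rewrite [f _]linearP [f0 _]linearP !scalerDr opprD addrACA scalerN !scalerA mulrC.
have -> : xi f = xi (mklin dL) + c *: xi f0.
  by rewrite (xiL c f0 (mklin dL) f) 1?addrC// => u; rewrite addrC subrK.
rewrite xS => [|_ /S0y1[t [b [S0t ->]]]] /=.
  by rewrite [f (_ + _)]linearD [f (_ *: _)]linearZ/= fy -addrA [- _ + _]addrC -scalerBr w1E !scalerA mulrC.
by rewrite [f _]linearD [f0 _]linearD [f (_ *: _)]linearZ [f0 (_ *: _)]linearZ fS0// f0S0// !add0r/= fy f0y scalerA mulrC -scalerA subrr.
Qed.

End Cogenerators.

(** * Right almost split morphisms *)

Section Dual.
Variables (R : comNzRingType) (L : algType R) (I : lmodType R).
Implicit Types X Y : lmodType L.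

Lemma dual_funD (f g : dual L I) a : dual_fun (f + g) a = dual_fun f a + dual_fun g a.
Proof. by []. Qed.

Lemma dual_funZ c (f : dual L I) a : dual_fun (c *: f) a = dual_fun f (a * c).
Proof. by []. Qed.

Lemma dual_eval_linear (b : L) : linear (fun f : restr (dual L I) => dual_fun f b).
Proof.
move=> r f g; rewrite restrZ dual_funD dual_funZ -scalerAr mulr1; congr (_ + _).
by rewrite /dual_fun linearZ.
Qed.

Lemma flen_dual : fin_gen (L : lmodType R) -> flenT I -> flenT (restr (dual L I)).
Proof.
move=> [n [g gL]] fI.
apply: (flen_joint (f := fun i : 'I_n => mklin (dual_eval_linear (g i))) fI) => f f0.
apply: dual_ext => x; have [c ->] := gL x.
rewrite [LHS](linear_for_sum (f : {linear L -> I})) big1// => i _.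
by rewrite [X in _ *: X](f0 i) scaler0.
Qed.

Fact dual_elt_linear Y (eta : {linear restr Y -> I}) (y : Y) :
  linear (fun a : L => eta (a *: y)).
Proof. by move=> r a b; rewrite scalerDl restr_scaleAl linearP. Qed.

Definition dual_elt Y (eta : {linear restr Y -> I}) (y : Y) : dual L I :=
  mklin (dual_elt_linear eta y).

Fact dual_map_linear Y (eta : {linear restr Y -> I}) : linear (dual_elt eta).
Proof.
move=> c y z; apply: dual_ext => a; rewrite dual_funD dual_funZ /dual_fun /=.
by rewrite scalerDr scalerA linearD.
Qed.

(* Hom_R(Y, I) = Hom_L(Y, D L) *)
Definition dual_map Y (eta : {linear restr Y -> I}) : {linear Y -> dual L I} :=
  mklin (dual_map_linear eta).

Lemma dual_mapE Y (eta : {linear restr Y -> I}) y a :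
  dual_fun (dual_map eta y) a = eta (a *: y).
Proof. by []. Qed.

Lemma dual_map_neq0 Y (eta : {linear restr Y -> I}) y :
  eta y <> 0 -> dual_map eta y <> 0.
Proof.
move=> ey /(congr1 (fun f : dual L I => dual_fun f 1)).
by rewrite dual_mapE scale1r.
Qed.

End Dual.

Section AlmostSplit.
Variables (R : comNzRingType) (L : algType R) (I : lmodType R).
Hypothesis artL : artin_algebra L.
Hypothesis Iinj : graph_injective I.
Implicit Types X Y : lmodType L.

Lemma fin_gen_cons X (x : X) : fin_gen X -> exists n (g : 'I_n.+1 -> X),
  g ord0 = x /\ forall y, exists c : 'I_n.+1 -> L, y = \sum_i c i *: g i.
Proof.
move=> [n [g gX]]; exists n, (fun i => if unlift ord0 i is Some j then g j else x).
split=> [|y]; first by rewrite unlift_none.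
have [c ->] := gX y; exists (fun i => if unlift ord0 i is Some j then c j else 0).
rewrite big_ord_recl unlift_none scale0r add0r; apply: eq_bigr => i _.
by rewrite liftK.
Qed.

Lemma lift_relations X Y n (g : 'I_n -> X) (y : 'I_n -> Y) :
  (forall x, exists c : 'I_n -> L, x = \sum_i c i *: g i) ->
  (forall c : 'I_n -> L, \sum_i c i *: g i = 0 -> \sum_i c i *: y i = 0) ->
  exists f : {linear X -> Y}, forall i, f (g i) = y i.
Proof.
move=> /choice[c cE] rel.
have relE c1 c2 : \sum_i c1 i *: g i = \sum_i c2 i *: g i ->
    \sum_i c1 i *: y i = \sum_i c2 i *: y i.
  move=> /eqP; rewrite -subr_eq0 -sumrB => /eqP E; apply/eqP.
  rewrite -subr_eq0 -sumrB; apply/eqP; rewrite -[RHS](rel (fun i => c1 i - c2 i)).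
    by apply: eq_bigr => i _; rewrite scalerBl.
  by rewrite -[RHS]E; apply: eq_bigr => i _; rewrite scalerBl.
have fL : linear (fun x => \sum_i c x i *: y i).
  move=> a u v; rewrite scaler_sumr -big_split/=.
  rewrite (relE _ (fun i => a * c u i + c v i)).
    by apply: eq_bigr => i _; rewrite scalerDl scalerA.
  rewrite -cE {1}(cE u) {1}(cE v) scaler_sumr -big_split/=.
  by apply: eq_bigr => i _; rewrite scalerDl scalerA.
exists (mklin fL) => i /=.
rewrite (relE _ (fun j => (j == i)%:R)) -?cE; rewrite (bigD1 i)//= eqxx scale1r big1 ?addr0//.
- by move=> j /negbTE->; rewrite scale0r.
- by move=> j /negbTE->; rewrite scale0r.
Qed.

(* Generators over R serve for the relations between elements of left and of
   right L-modules alike. *)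
Lemma relations_fin_gen n (P : {ffun 'I_n -> L} -> Prop) : submod P ->
  exists m (a : 'I_m -> {ffun 'I_n -> L}), (forall k, P (a k)) /\
    forall c, P c -> exists r : 'I_m -> R, c = \sum_k r k *: a k.
Proof. by apply: flen_gen; apply: flen_ffun; apply: flen_alg. Qed.

Section Right.
Hypothesis fI : flenT I.
Hypothesis Isim : meets_simples I.

(* Let x0 <> 0 be killed by the non-isomorphisms of End(X), psi x0 <> 0, and let
   g_0 = x0, g_1, .., g_n generate X with relations a_k. If h : Y -> X is
   radical then psi h vanishes on all images of x0 under X -> Y, that is, on the
   first components of the solutions in Y of the relations a_k; by injectivity
   of I it has the form psi h = sum_k eta_k a_k0 with sum_k eta_k a_kj = 0 for
   j > 0. So (h, eta) takes values in the submodule E of X * (D L)^m cut out by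
   these equations. *)
Lemma right_almost_split_mod X : indecomposable X -> fin_gen X ->
  exists (E : lmodType L) (p : {linear E -> X}), [/\ fin_gen E,
    ~ (exists s : {linear X -> E}, forall x, p (s x) = x) &
    forall Y (h : {linear Y -> X}), fin_gen Y -> rad h ->
      exists k : {linear Y -> E}, h = (p \o k : {linear Y -> X})].
Proof.
move=> iX gX; have fX := fin_gen_flen artL gX.
have fR : flenT (R^o : lmodType R) by apply: artinian_flen; case: artL.
have [x0 x0N soc] := ind_socle iX fX.
have [psi psi0] := separate0 fR Iinj Isim (W := restr X) fX x0N.
have [n [g [g0 gE]]] := fin_gen_cons x0 gX.
have sRel : submod (fun c : {ffun 'I_n.+1 -> L} => \sum_j c j *: g j = 0).
  split; first by rewrite big1// => j _; rewrite ffunE scale0r.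
  move=> r c d c0 d0.
  transitivity (r *: ((\sum_j c j *: g j) : restr X) + \sum_j d j *: g j : restr X); last first.
    by rewrite c0 d0 scaler0 addr0.
  rewrite scaler_sumr -big_split/=; apply: eq_bigr => j _.
  by rewrite !ffunE scalerDl restr_scaleAl.
have [m [a [aRel aGen]]] := relations_fin_gen sRel.
pose V := (X * {ffun 'I_m -> dual L I})%type.
(* For components of the form [dual_map] eta_k y this reads sum_k eta_k (a_kj b y) = psi (b x) if j
   = 0, and 0 otherwise. The quantifier over b makes S an L-submodule. *)
pose S (v : V) := forall j b, \sum_k dual_fun (v.2 k) (a k j * b) =
  if j == ord0 then psi (b *: v.1) else 0.
have sS : submod S.
  split=> [j b|c [x th] [x' th'] H H' j b].
    rewrite big1 => [|k _]; last by rewrite ffunE.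
    by rewrite scaler0 linear0 if_same.
  have E : \sum_k dual_fun ((c *: (x, th) + (x', th')).2 k) (a k j * b) =
      \sum_k dual_fun (th k) (a k j * (b * c)) + \sum_k dual_fun (th' k) (a k j * b).
    by rewrite -big_split/=; apply: eq_bigr => k _; rewrite !ffunE dual_funD dual_funZ mulrA.
  rewrite {}E (H j (b * c)) (H' j b) /=; case: ifP => _; last by rewrite addr0.
  by rewrite scalerDr linearD scalerA.
exists (submod_type sS), (fst \o submod_incl sS : {linear _ -> X}).
have fV : flenT (restr V).
  have fL : linear (fun v : restr V => (v.1 : restr X, [ffun k => v.2 k : restr (dual L I)])).
    move=> r v w; apply: injective_projections => //=.
    by apply/ffunP => k; rewrite !ffunE.
  apply: (flen_inj (f := mklin fL)).
    move=> [x th] [x' th'] [-> /ffunP E]; congr pair; apply/ffunP => k.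
    by have := E k; rewrite !ffunE.
  by apply: flen_prod => //; apply: flen_ffun; apply: flen_dual => //; case: artL.
split.
- apply: flen_restr_fin_gen; apply: (flen_inj (f := restr_map (submod_incl sS)) _ fV).
  exact: submod_incl_inj.
- move=> [s sE]; have {}sE x : (submod_incl sS (s x)).1 = x by exact: sE.
  pose eta k (x : X) := dual_fun ((submod_incl sS (s x)).2 k) 1.
  have etaE k x b : dual_fun ((submod_incl sS (s x)).2 k) b = eta k (b *: x).
    by rewrite /eta !linearZ /= ffunE dual_funZ mul1r.
  have etaD k x y : eta k (x + y) = eta k x + eta k y.
    by rewrite /eta !linearD /= ffunE.
  have eta0 k : eta k 0 = 0 by rewrite /eta !linear0 /= ffunE.
  apply: psi0; rewrite -g0.
  have H j x : \sum_k eta k (a k j *: x) = if j == ord0 then psi x else 0.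
    have := submod_inclP (s x) j 1; rewrite sE scale1r => <-.
    by apply: eq_bigr => k _; rewrite etaE mulr1.
  (* Summing in the other order gives psi x0 = sum_k eta_k (sum_j a_kj g_j) = 0. *)
  transitivity (\sum_j \sum_k eta k (a k j *: g j)).
    rewrite (bigD1 ord0)//= H eqxx big1 ?addr0// => j /negbTE j0.
    by rewrite H j0.
  rewrite exchange_big big1//= => k _.
  by rewrite -(big_morph _ (etaD k) (eta0 k)) aRel.
- move=> Y h gY rh; have fY := fin_gen_flen artL gY.
  pose eta : {linear restr Y -> I} := psi \o restr_map h.
  pose W := {ffun 'I_m -> restr Y}.
  (* The graph of (sum_j a_kj y_j)_k |-> psi h y_0. It is well defined: a solution y of the
     relations is the image of the generators under some f : X -> Y, and h f kills x0. *)
  pose G (p : W * I) := exists2 y : 'I_n.+1 -> Y,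
    forall k, p.1 k = \sum_j a k j *: y j & p.2 = eta (y ord0).
  have [||phi phiP] := Iinj (W := W) (flen_ffun _ fY) (G := G).
  + split; first exists (fun=> 0); rewrite /= ?linear0//.
      by move=> k; rewrite ffunE big1// => j _; rewrite scaler0.
    move=> r [w v] [w' v'] [y /= yw ->] [y' /= yw' ->].
    exists (fun j => (r *: (y j : restr Y)) + y' j) => [k|]; last by rewrite /= -(linearP eta).
    rewrite /= !ffunE yw yw' scaler_sumr -big_split/=; apply: eq_bigr => j _.
    by rewrite scalerDr restr_scaleC.
  + move=> v [y /= y0 ->].
    have [f fy] : exists f : {linear X -> Y}, forall i, f (g i) = y i.
      apply: lift_relations => // c c0.
      have [|r rE] := aGen [ffun j => c j].
        by rewrite -[RHS]c0; apply: eq_bigr => j _; rewrite ffunE.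
      transitivity (\sum_k (r k *: ((\sum_j a k j *: y j) : restr Y)) : Y); last first.
        by apply: big1 => k _; rewrite -y0 ffunE scaler0.
      transitivity (\sum_j \sum_k (r k *: ((a k j *: y j : Y) : restr Y) : Y)).
        apply: eq_bigr => j _; have /ffunP/(_ j) := rE; rewrite ffunE => ->.
        rewrite sum_ffunE scaler_suml; apply: eq_bigr => k _.
        by rewrite ffunE restr_scaleAl.
      by rewrite exchange_big; apply: eq_bigr => k _; rewrite scaler_sumr.
    rewrite -fy g0 /eta /= (_ : h (f x0) = 0) ?linear0//.
    apply: (soc (h \o f : {linear X -> X})).
    by apply: rad_not_iso_r => //; case: iX.
  pose del k (y : restr Y) : W := [ffun k' => if k' == k then y else 0].
  have delL k : linear (del k).
    move=> r u v; apply/ffunP => i; rewrite !ffunE.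
    by case: ifP => // _; rewrite scaler0 addr0.
  pose eta' k : {linear restr Y -> I} := phi \o mklin (delL k).
  have phiE w : phi w = \sum_k eta' k (w k).
    rewrite -linear_sum; congr (phi _); apply/ffunP => i; rewrite sum_ffunE.
    rewrite (bigD1 i)//= ffunE eqxx big1 ?addr0// => k ki.
    by rewrite ffunE eq_sym (negbTE ki).
  have kL : linear (fun y : Y => (h y, [ffun k => dual_map (eta' k) y]) : V).
    move=> c y z; apply: injective_projections; rewrite /= ?linearP//.
    by apply/ffunP => k; rewrite !ffunE; exact: (linearP (dual_map (eta' k))).
  have [|k kE] := submod_lift sS (f := mklin kL).
    move=> y j b /=.
    transitivity (phi [ffun k => (a k j *: (b *: y) : Y)]).
      by rewrite phiE; apply: eq_bigr => k _; rewrite !ffunE dual_mapE scalerA.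
    apply: phiP; exists (fun j' => if j' == j then b *: y else 0) => /=.
      move=> k; rewrite ffunE (bigD1 j)//= eqxx big1 ?addr0// => j' /negbTE->.
      by rewrite scaler0.
    by rewrite eq_sym; case: ifP => _; rewrite ?linear0// /eta /= linearZ.
  by exists k; apply: linear_eq => y /=; have := kE y => /(congr1 fst).
Qed.

End Right.
End AlmostSplit.

(** * Left almost split morphisms *)

Section Left.
Variables (R : comNzRingType) (L : algType R) (I : lmodType R).
Hypothesis artL : artin_algebra L.
Hypothesis Iinj : graph_injective I.
Hypothesis Isoc : socle_multiplicity_one I.
Hypothesis fD : flenT (restr (dual L I)).
Implicit Types X Y : lmodType L.

Let fR : flenT (R^o : lmodType R).
Proof. by apply: artinian_flen; case: artL. Qed.

(** Finite length is available for D L rather than for I, so D X is embedded in (D L)^p through p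
    generators of X. The given psi is put in front as the 0-th generator. *)
Lemma functionals_fin_gen X (psi : {linear restr X -> I}) : fin_gen X ->
  exists n (f : 'I_n.+1 -> {linear restr X -> I}), f ord0 = psi /\
    forall eta : {linear restr X -> I}, exists c : 'I_n.+1 -> R,
      forall x, eta x = \sum_j c j *: f j x.
Proof.
move=> [p [g gX]].
pose T (th : {ffun 'I_p -> restr (dual L I)}) :=
  exists eta : {linear restr X -> I}, forall i, th i = dual_map eta (g i).
have sT : submod T.
  split.
    by exists \0 => i; rewrite ffunE; apply: dual_ext.
  move=> r th th' [eta E] [eta' E'].
  have eL : linear (fun x => r *: eta x + eta' x).
    move=> c x y; rewrite [eta _]linearP [eta' _]linearP !scalerDr !scalerA addrACA; congr (_ + _ + _).
    by rewrite mulrC.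
  exists (mklin eL) => i; rewrite !ffunE E E' restrZ; apply: dual_ext => b.
  rewrite dual_funD dual_funZ !dual_mapE /= -scalerAr mulr1 restr_scaleAl.
  by rewrite linearZ.
have [n [th [thT thgen]]] := flen_gen (flen_ffun p fD) sT.
have /choice[f fE] k : exists eta : {linear restr X -> I},
    forall i, th k i = dual_map eta (g i) by exact: thT.
exists n, (fun i => if unlift ord0 i is Some j then f j else psi).
split=> [|eta]; first by rewrite unlift_none.
have [|c cE] := thgen [ffun i => dual_map eta (g i)].
  by exists eta => i; rewrite ffunE.
exists (fun i => if unlift ord0 i is Some j then c j else 0) => x.
rewrite big_ord_recl unlift_none scale0r add0r.
rewrite (eq_bigr (fun j => c j *: f j x)); last by move=> j _; rewrite liftK.
have [b ->] := gX x.
rewrite linear_sum (eq_bigr (fun j => \sum_i c j *: f j (b i *: g i))); last first.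
  by move=> j _; rewrite linear_sum scaler_sumr.
rewrite exchange_big; apply: eq_bigr => i _.
have /ffunP/(_ i) := cE; rewrite ffunE sum_ffunE => E.
rewrite -dual_mapE E.
rewrite -[LHS]/(mklin (dual_eval_linear (I := I) (b i)) _) linear_sum.
by apply: eq_bigr => j _; rewrite ffunE linearZ/= fE.
Qed.

(* Hom_L(Y, X) = Hom(D X, D Y): a solution in D Y of the relations between
   generators of D X comes from a map Y -> X, since X is reflexive. *)
Lemma lift_functionals X Y n (f : 'I_n -> {linear restr X -> I})
    (eta : 'I_n -> {linear restr Y -> I}) : fin_gen X ->
  (forall g : {linear restr X -> I}, exists c : 'I_n -> R,
     forall x, g x = \sum_j c j *: f j x) ->
  (forall c : 'I_n -> L, (forall x : X, \sum_j f j (c j *: x) = 0) ->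
     forall y : Y, \sum_j eta j (c j *: y) = 0) ->
  exists g : {linear Y -> X}, forall j y, f j (g y) = eta j y.
Proof.
move=> gX fgen rel; have fX := fin_gen_flen artL gX.
have Isim := submod_socle_mult_simples Isoc.
have relE (c c' : 'I_n -> L) :
    (forall x : X, \sum_j f j (c j *: x) = \sum_j f j (c' j *: x)) ->
    forall y : Y, \sum_j eta j (c j *: y) = \sum_j eta j (c' j *: y).
  move=> E y; apply/eqP; rewrite -subr_eq0 -sumrB; apply/eqP.
  rewrite -[RHS](rel (fun j => c j - c' j) _ y) => [|x].
    by apply: eq_bigr => j _; rewrite scalerBl linearB.
  have /eqP := E x; rewrite -subr_eq0 -sumrB => /eqP; move=> E'; rewrite -[RHS]E'.
  by apply: eq_bigr => j _; rewrite scalerBl linearB.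
have /choice[c cE] (g : {linear restr X -> I}) :
    exists c : 'I_n -> L, forall x : X, g x = \sum_j f j (c j *: x).
  have [c cE] := fgen g; exists (fun j => (c j)%:A) => x; rewrite cE.
  by apply: eq_bigr => j _; rewrite -restrZ linearZ.
(* g y is the point of X whose evaluation is phi |-> sum_j eta_j (c_j y), where phi = sum_j f_j c_j;
   [relE] makes this linear in phi. *)
have /choice[g gE] y : exists x : X, forall phi : {linear restr X -> I},
    \sum_j eta j (c phi j *: y) = phi x.
  have [|x xE] := reflexive Iinj (W := restr X)
    (xi := fun phi => \sum_j eta j (c phi j *: y)) Isoc fX; last by exists x.
  move=> r p1 p2 p E; rewrite (relE _ (fun j => r *: c p1 j + c p2 j)).
    rewrite scaler_sumr -big_split/=; apply: eq_bigr => j _.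
    by rewrite scalerDl restr_scaleAl linearP.
  move=> x; rewrite -cE E !cE scaler_sumr -big_split/=; apply: eq_bigr => j _.
  by rewrite scalerDl restr_scaleAl linearP.
have phiL (l : 'I_n -> L) : linear (fun x : restr X => \sum_j f j (l j *: (x : X))).
  move=> r x y; rewrite scaler_sumr -big_split/=; apply: eq_bigr => j _.
  by rewrite scalerDr restr_scaleC linearP.
have gstar (l : 'I_n -> L) y : \sum_j f j (l j *: g y) = \sum_j eta j (l j *: y).
  rewrite -[LHS]/(mklin (phiL l) (g y)) -gE; apply: relE => x.
  by rewrite -cE.
(* Functionals separate points, so linearity is tested after applying each phi. *)
have gL : linear g.
  move=> a y z; apply: contrapT => ne.
  have [|phi] := separate0 fR Iinj Isim (W := restr X) (y := g (a *: y + z) - (a *: g y + g z)) fX.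
    by move/subr0_eq.
  have E : \sum_j f j (c phi j *: (a *: g y)) = \sum_j eta j (c phi j *: (a *: y)).
    transitivity (\sum_j f j ((c phi j * a) *: g y)).
      by apply: eq_bigr => j _; rewrite scalerA.
    rewrite (gstar (fun j => c phi j * a)).
    by apply: eq_bigr => j _; rewrite scalerA.
  apply; rewrite linearB; apply/eqP; rewrite subr_eq0 linearD !(cE phi) E !gstar; apply/eqP.
  by rewrite -big_split/=; apply: eq_bigr => j _; rewrite scalerDr linearD.
exists (mklin gL) => i y /=.
have := gstar (fun j => (j == i)%:R) y.
rewrite (bigD1 i)//= eqxx scale1r big1 => [|j /negbTE->]; last by rewrite scale0r linear0.
rewrite addr0 => ->; rewrite (bigD1 i)//= eqxx scale1r big1 ?addr0// => j /negbTE->.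
by rewrite scale0r linear0.
Qed.

(* The dual construction: with generators psi = f_0, .., f_n of D X and relations
   a_k between them, h : X -> Y being radical makes (h x0, 0, .., 0) orthogonal to
   all solutions in D Y of the relations, hence h x0 = sum_k a_k0 y_k and
   0 = sum_k a_kj y_k for j > 0. So h factors through the quotient E of X * L^m
   imposing these equations. *)
Lemma left_almost_split_mod X : indecomposable X -> fin_gen X ->
  exists (E : lmodType L) (q : {linear X -> E}), [/\ fin_gen E,
    ~ (exists r : {linear E -> X}, forall x, r (q x) = x) &
    forall Y (h : {linear X -> Y}), fin_gen Y -> rad h ->
      exists k : {linear E -> Y}, h = (k \o q : {linear X -> Y})].
Proof.
move=> iX gX; have fX := fin_gen_flen artL gX.
have Isim := submod_socle_mult_simples Isoc.
have [x0 x0N soc] := ind_socle iX fX.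
have [psi psi0] := separate0 fR Iinj Isim (W := restr X) fX x0N.
have [n [f [f0 fgen]]] := functionals_fin_gen psi gX.
have sRel : submod (fun c : {ffun 'I_n.+1 -> L} => forall x : X, \sum_j f j (c j *: x) = 0).
  split=> [x|r c d c0 d0 x].
    by rewrite big1// => j _; rewrite ffunE scale0r linear0.
  transitivity (r *: (\sum_j f j (c j *: x)) + \sum_j f j (d j *: x)); last first.
    by rewrite c0 d0 scaler0 addr0.
  rewrite scaler_sumr -big_split/=; apply: eq_bigr => j _.
  by rewrite !ffunE scalerDl restr_scaleAl linearP.
have [m [a [aRel aGen]]] := relations_fin_gen artL sRel.
pose V := (X * {ffun 'I_m -> L^o})%type.
(* With y_k the class of the k-th basis vector of L^m, killing the image of the j-th basis vector
   imposes sum_k a_kj y_k = x0 for j = 0, and = 0 otherwise. *)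
have nuL : linear (fun b : {ffun 'I_n.+1 -> L^o} =>
    (b ord0 *: x0, [ffun k => - \sum_j b j * a k j]) : V).
  move=> c b b'; apply: injective_projections => /=.
    by rewrite !ffunE scalerDl scalerA.
  apply/ffunP => k; rewrite !ffunE scalerN -opprD; congr (- _).
  rewrite scaler_sumr -big_split/=; apply: eq_bigr => j _.
  by rewrite !ffunE mulrDl -mulrA.
have sN := submod_image (mklin nuL) (submodT _).
have iL : linear (fun x : X => (x, 0) : V).
  by move=> c x y; apply: injective_projections; rewrite //= scaler0 addr0.
pose pr := quot_proj sN.
exists (quotmod sN), (pr \o mklin iL : {linear X -> _}).
have fV : flenT (restr V).
  have fL : linear (fun v : restr V => (v.1 : restr X, [ffun k => v.2 k : L])).
    move=> r v w; apply: injective_projections => //=.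
    by apply/ffunP => k; rewrite !ffunE /= /GRing.scale /= -scalerAl mul1r.
  apply: (flen_inj (f := mklin fL)).
    move=> [x th] [x' th'] [-> /ffunP E]; congr pair; apply/ffunP => k.
    by have := E k; rewrite !ffunE.
  by apply: flen_prod => //; apply: flen_ffun; apply: flen_alg.
split.
- apply: flen_restr_fin_gen; apply: (flen_preim (f := restr_map pr) _ fV).
  exact: quot_proj_surj.
- move=> [r rE].
  have i2L : linear (fun w : {ffun 'I_m -> L^o} => (0, w) : V).
    by move=> c x y; apply: injective_projections; rewrite //= scaler0 addr0.
  pose del k : {ffun 'I_m -> L^o} := [ffun i => (i == k)%:R].
  pose y k : X := r (pr (0, del k)).
  have prE x w : r (pr (x, w)) = x + \sum_k w k *: y k.
    have -> : (x, w) = mklin iL x + mklin i2L (\sum_k w k *: del k) :> V.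
      apply: injective_projections; rewrite /= ?addr0// add0r.
      apply/ffunP => i; rewrite sum_ffunE (bigD1 i)//= big1 => [|k ki].
        by rewrite !ffunE eqxx addr0 /GRing.scale /= mulr1.
      by rewrite !ffunE eq_sym (negbTE ki) scaler0.
    rewrite [pr _]linearD linearD; congr (_ + _); first exact: rE.
    pose F : {linear {ffun 'I_m -> L^o} -> X} := r \o (pr \o mklin i2L).
    exact: (linear_for_sum F del w).
  have rel j : \sum_k a k j *: y k = if j == ord0 then x0 else 0.
    pose b : {ffun 'I_n.+1 -> L^o} := [ffun i => (i == j)%:R].
    have : r (pr (mklin nuL b)) = 0.
      rewrite (_ : pr _ = 0) ?linear0//; apply/quot_proj_eq0.
      by exists b.
    rewrite prE => /eqP; rewrite addr_eq0 -sumrN => /eqP E.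
    transitivity (b ord0 *: x0).
      rewrite E; apply: eq_bigr => k _; rewrite ffunE scaleNr opprK; congr (_ *: _).
      rewrite (bigD1 j)//= ffunE eqxx mul1r big1 ?addr0// => i /negbTE ij.
      by rewrite ffunE ij mul0r.
    by rewrite ffunE eq_sym; case: ifP => _; rewrite ?scale1r ?scale0r.
  apply: psi0; rewrite -f0.
  transitivity (\sum_j \sum_k f j (a k j *: y k)).
    rewrite (bigD1 ord0)//= -linear_sum rel eqxx big1 ?addr0// => j /negbTE j0.
    by rewrite -linear_sum rel j0 linear0.
  by rewrite exchange_big big1//= => k _; exact: aRel.
- move=> Y h gY rh; have fY := fin_gen_flen artL gY.
  pose W := {ffun 'I_n.+1 -> restr Y}.
  pose S (w : W) := exists y : 'I_m -> Y, forall j, w j = \sum_k a k j *: y k.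
  have sS : submod S.
    split; first exists (fun=> 0) => j.
      by rewrite ffunE big1// => k _; rewrite scaler0.
    move=> r w w' [y yw] [y' yw']; exists (fun k => (r *: (y k : restr Y)) + y' k) => j.
    rewrite !ffunE yw yw' scaler_sumr -big_split/=; apply: eq_bigr => k _.
    by rewrite scalerDr restr_scaleC.
  have [y yE] : S [ffun j => if j == ord0 then h x0 else 0].
    (* A functional vanishing on S but not on this vector has components eta_j that satisfy the
       relations; they are f_j g for some g : Y -> X, and g h kills x0. *)
    apply: contrapT => /(separate fR Iinj Isim (flen_ffun _ fY) sS)[phi [phiS]]; apply.
    pose del j (y : restr Y) : W := [ffun j' => if j' == j then y else 0].
    have delL j : linear (del j).
      move=> r u v; apply/ffunP => i; rewrite !ffunE.
      by case: ifP => // _; rewrite scaler0 addr0.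
    pose eta j : {linear restr Y -> I} := phi \o mklin (delL j).
    have phiE w : phi w = \sum_j eta j (w j).
      rewrite -linear_sum; congr (phi _); apply/ffunP => i; rewrite sum_ffunE.
      rewrite (bigD1 i)//= ffunE eqxx big1 ?addr0// => j ji.
      by rewrite ffunE eq_sym (negbTE ji).
    have aeta k y : \sum_j eta j (a k j *: y) = 0.
      transitivity (phi [ffun j => (a k j *: y : Y)]).
        by rewrite phiE; apply: eq_bigr => j _; rewrite ffunE.
      apply: phiS; exists (fun k' => if k' == k then y else 0) => j.
      rewrite ffunE (bigD1 k)//= eqxx big1 ?addr0// => k' /negbTE->.
      by rewrite scaler0.
    have [|g gE] := lift_functionals (f := f) (eta := eta) gX fgen.
      move=> c c0 y.
      have [|r rE] := aGen [ffun j => c j].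
        by move=> x; rewrite -[RHS](c0 x); apply: eq_bigr => j _; rewrite ffunE.
      transitivity (\sum_k r k *: (\sum_j eta j (a k j *: y))); last first.
        by apply: big1 => k _; rewrite aeta scaler0.
      transitivity (\sum_j \sum_k (r k *: eta j (a k j *: y))).
        apply: eq_bigr => j _; have /ffunP/(_ j) := rE; rewrite ffunE => ->.
        rewrite sum_ffunE scaler_suml linear_sum; apply: eq_bigr => k _.
        by rewrite ffunE restr_scaleAl linearZ.
      by rewrite exchange_big; apply: eq_bigr => k _; rewrite scaler_sumr.
    rewrite phiE big1// => j _; rewrite ffunE; case: eqP => [->|_]; last exact: linear0.
    rewrite -gE f0 (_ : g (h x0) = 0) ?linear0//.
    apply: (soc (g \o h : {linear X -> X})).
    by apply: rad_not_iso_l => //; case: iX.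
  have kL : linear (fun v : V => h v.1 + \sum_k v.2 k *: y k).
    move=> c v w; rewrite /= linearP scalerDr addrACA; congr (_ + _).
    rewrite scaler_sumr -big_split/=; apply: eq_bigr => k _.
    by rewrite !ffunE scalerDl scalerA.
  have [|k kE] := quot_factor sN (f := mklin kL).
    move=> _ [b _ ->] /=; rewrite linearZ/=.
    have -> : h x0 = \sum_k a k ord0 *: y k by rewrite -yE ffunE.
    have E : \sum_j b j *: (\sum_k a k j *: y k) = b ord0 *: (\sum_k a k ord0 *: y k).
      rewrite (bigD1 ord0)//= [X in _ + X]big1 ?addr0// => j /negbTE j0.
      by rewrite -yE ffunE j0 scaler0.
    apply/eqP; rewrite addr_eq0 -E -sumrN; apply/eqP.
    under eq_bigr do rewrite scaler_sumr.
    rewrite exchange_big; apply: eq_bigr => k _ /=.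
    rewrite ffunE scaleNr opprK scaler_suml; apply: eq_bigr => j _.
    by rewrite scalerA.
  exists k; apply: linear_eq => x; rewrite /= -[LHS]addr0.
  rewrite -[RHS]/(k (pr (x, 0))) kE /=; congr (_ + _).
  by rewrite big1// => i _; rewrite ffunE scale0r.
Qed.

End Left.

(** * Injective modules of finite length *)

Section MaxIdeals.
Variable R : comNzRingType.
Implicit Types m : R^o -> Prop.

Lemma max_ideal_inv m (x : R) : max_ideal m -> ~ m x -> exists b, m (1 - b * x).
Proof.
move=> [sm m1 maxm] mx; apply: contrapT => nb; apply: mx.
have sU := submod_add sm (submod_cyclic (x : R^o)).
apply: (maxm _ sU).
- move=> r mr; exists r, 0; rewrite addr0; split=> //.
  by exists 0; rewrite scale0r.
- move=> [s [_ [ms [b ->] E]]]; apply: nb; exists b.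
  by rewrite E addrK.
- exists 0, x; rewrite add0r; split=> //; first exact: submod0.
  by exists 1; rewrite scale1r.
Qed.

Lemma max_ideal_prime m (x y : R) : max_ideal m -> ~ m x -> ~ m y -> ~ m (x * y).
Proof.
move=> mm mx my mxy; have [sm m1 _] := mm; have [b mb] := max_ideal_inv mm mx.
apply: my; rewrite -[y]mul1r -(subrK (b * x) 1) mulrDl; apply: (submodD sm).
  by rewrite mulrC; apply: (submodZ sm).
by rewrite -mulrA; apply: (submodZ sm).
Qed.

Lemma max_ideal_fixed (V : lmodType R) m (x : R) (v : V) : max_ideal m ->
  ~ m x -> (forall a, m a -> a *: v = 0) -> exists b, v = b *: (x *: v).
Proof.
move=> mm mx mv; have [b /mv] := max_ideal_inv mm mx.
rewrite scalerBl scale1r => /subr0_eq vE; exists b.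
by rewrite scalerA.
Qed.

Hypothesis fR : flenT (R^o : lmodType R).

(** Let T be minimal among finite intersections of maximal ideals. Every m contains T, and being
    prime it contains one of the ideals that form T. *)
Lemma max_ideals_finite : exists n (M : 'I_n -> R^o -> Prop),
  (forall i, max_ideal (M i)) /\
  forall m, max_ideal m -> exists i, forall x, m x <-> M i x.
Proof.
have [|T [sT [n [M [MM TM]]] _ minT]] := @flen_min R R^o
  (fun T => exists n (M : 'I_n -> R^o -> Prop), (forall i, max_ideal (M i)) /\
     forall x, T x <-> forall i, M i x) _ fR (submodT _).
  by exists 0%N, (fun=> fun=> True); split=> [[]|x]; split=> // _ [].
exists n, M; split=> // m mm; have [sm m1 _] := mm.
have Tm x : T x -> m x.
  move=> Tx; suff [] : T x /\ m x by [].
  apply: (minT (fun x => T x /\ m x)) => //; last by move=> y [].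
    exact: submodI.
  exists n.+1, (fun i => if unlift ord0 i is Some j then M j else m); split=> [i|y].
    by case: unliftP => [j _|_].
  split=> [[Ty my] i|all].
    by case: unliftP => [j _|_] //; move/TM: Ty; apply.
  split; last by have := all ord0; rewrite unlift_none.
  by apply/TM => i; have := all (lift ord0 i); rewrite liftK.
have [i Mim] : exists i, forall x, M i x -> m x.
  apply: contrapT => /forallNP nM.
  have /choice[x xP] i : exists x, M i x /\ ~ m x.
    by have /existsNP[x /not_implyP] := nM i; exists x.
  have : m (\prod_i x i).
    apply/Tm/TM => i; rewrite (bigD1 i)//= mulrC.
    by have [sMi _ _] := MM i; apply: (submodZ sMi); case: (xP i).
  by elim/big_ind: _ => [//|y z|i _]; [exact: max_ideal_prime|case: (xP i)].
exists i => x; split; last exact: Mim.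
by have [_ _ maxMi] := MM i; move: x; apply: maxMi.
Qed.

End MaxIdeals.

(** * The injective envelope of R / J_R *)

Section Envelope.
Variables (R : comNzRingType) (I : lmodType R) (e : {linear residue_ring R -> I}).
Hypothesis fR : flenT (R^o : lmodType R).
Hypothesis envI : injective_envelope e.

Lemma injective_graph_injective (J : lmodType R) :
  injective_module J -> graph_injective J.
Proof.
move=> Jinj W fW G sG G0.
have GU w v v' : G (w, v) -> G (w, v') -> v = v'.
  move=> Gv Gv'; apply/subr0_eq/G0; have := submodB sG Gv Gv'.
  by congr G; apply: injective_projections; rewrite /= ?subrr.
have sS : submod (fun w => exists v, G (w, v)).
  split; first by exists 0; apply: (submod0 sG).
  move=> a w w' [v Gv] [v' Gv']; exists (a *: v + v').
  by have [_ /(_ a _ _ Gv Gv')] := sG.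
have /choice[f fP] s : exists v, G (submod_incl sS s, v) by exact: (submod_inclP s).
have fL : linear f.
  move=> a s s'; apply: (GU _ _ _ (fP _)); rewrite linearP.
  by have [_ /(_ a _ _ (fP s) (fP s'))] := sG.
have [h hf] := Jinj _ _ (submod_incl sS) (mklin fL) (submod_incl_inj (sS := sS)).
exists h => w v Gwv; have [|s sE] := submod_incl_surj sS (x := w); first by exists v.
rewrite -sE -[LHS]/((h \o submod_incl sS) s) hf; apply: (GU w) => //.
by rewrite -sE; apply: fP.
Qed.

Let pi (x : R^o) : residue_ring R := \pi_(Quotient.quot (jacobson_zmod R)) x.

Let piZ a x : a *: pi x = pi (a * x).
Proof. exact: residue_scaleE. Qed.

Let pi_surj u : exists x, pi x = u.
Proof. by exists (repr (u : Quotient.quot (jacobson_zmod R))); rewrite /pi reprK. Qed.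

Let pi_eq x y : pi x = pi y <-> jacobson (x - y).
Proof.
split=> [/eqP|J]; first by rewrite -Quotient.idealrBE.
by apply/eqP; rewrite -Quotient.idealrBE.
Qed.

Let pi0 : pi 0 = 0.
Proof. by rewrite /pi raddf0. Qed.

Lemma max_ideal_pred (m : R^o -> Prop) : max_ideal m ->
  maximal_ideal (fun x : R => `[<m x>]).
Proof.
move=> [sm m1 maxm]; split.
  split; [exact/asboolP/(submod0 sm)|exact/asboolP|].
  by move=> a u v /asboolP mu /asboolP mv; apply/asboolP; case: sm => _; apply.
move=> n [n0 n1 nD] mn x nx; apply/asboolP.
apply: (maxm (fun x => x \in n)) => //.
- by move=> r /asboolP mr; apply: mn.
- by apply/negP.
Qed.

(** The m-part of R / J_R is spanned by the class of some y0 outside m with m y0 in J_R. By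
    essentiality a non-zero v killed by m has a non-zero multiple r v in the image of [e]; r is
    invertible on v, so v is in the image too. *)
Lemma envelope_socle : socle_multiplicity_one I.
Proof.
move=> m mm; have [sm m1 maxm] := mm; have [_ [eI ess]] := envI.
(* K is minimal among the ideals not contained in m. A maximal ideal n not contained in m contains
   y0, because the intersection of K and n is again not contained in m. *)
have [|K [sK [y0 Ky0 my0] _ minK]] := @flen_min R R^o
    (fun K => exists2 y, K y & ~ m y) _ fR (submodT _); first by exists 1.
have y0J a : m a -> jacobson (a * y0).
  move=> ma; apply/asboolP => n nM; have [[n0 n1 nD] maxn] := nM.
  have sn : submod (fun x : R^o => x \in n) by split=> // b x y; apply: nD.
  have [[k nk mk]|nm] := pselect (exists2 k, k \in n & ~ m k); last first.
    suff an : a \in n by rewrite mulrC; apply: (submodZ sn).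
    have mI := max_ideal_pred mm.
    apply: (maxn (fun x : R => `[<m x>])); [by case: mI| |exact/asboolP].
    move=> x nx; apply/asboolP; apply: contrapT => mx.
    by apply: nm; exists x.
  have [] : K y0 /\ y0 \in n; last by move=> _ y0n; apply: (submodZ sn).
  apply: (minK (fun x => K x /\ x \in n)) => //; last by move=> x [].
    exact: submodI.
  exists (k * y0); last exact: max_ideal_prime.
  split; first exact: (submodZ sK).
  by rewrite mulrC; apply: (submodZ sn).
have y0N : ~ jacobson y0.
  move=> /asboolP/(_ _ (max_ideal_pred mm)) y0m.
  by apply: my0; apply/asboolP.
exists (e (pi y0)); split.
- rewrite -(linear0 e) => /eI; rewrite -pi0 => /pi_eq; rewrite subr0; exact: y0N.
- move=> a ma; rewrite -linearZ piZ (_ : pi _ = 0) ?linear0// -pi0.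
  by apply/pi_eq; rewrite subr0; apply: y0J.
move=> v mv; have [->|/eqP v0] := eqVneq v 0; first by exists 0; rewrite scale0r.
have [||u /asboolP[r uE] u0] := ess (fun x => `[<exists r, x = r *: v>]).
- have [S0 SD] := submod_cyclic v; split; first exact/asboolP.
  by move=> a x y /asboolP Sx /asboolP Sy; apply/asboolP; apply: SD.
- by exists v; [apply/asboolP; exists 1; rewrite scale1r|apply/eqP].
have nmr : ~ m r by move=> mr; move: u0; rewrite uE mv// eqxx.
have [b vE] := max_ideal_fixed mm nmr mv.
have [y yE] := pi_surj (b *: u).
have evy : e (pi y) = v by rewrite yE linearZ uE.
have myJ a : m a -> jacobson (a * y).
  move=> ma; rewrite -[a * y]subr0; apply/pi_eq; apply: eI.
  by rewrite -piZ linearZ/= evy mv// pi0 linear0.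
(* Since 1 - c y0 lies in m, the elements y and c y y0 agree modulo J_R. *)
have [c mc] := max_ideal_inv mm my0.
exists (c * y); rewrite -linearZ -evy; congr (e _); rewrite piZ; apply/pi_eq.
by rewrite mulrAC -{1}[y]mul1r -mulrBl; apply: myJ.
Qed.

End Envelope.

(** * Essential extensions of R / m *)

Section EssentialExtensions.
Variables (R : comNzRingType) (m : R^o -> Prop).
Hypothesis fR : flenT (R^o : lmodType R).
Hypothesis mm : max_ideal m.

(** w spans a copy of R / m that is contained in every non-zero submodule of V. *)
Definition essential_simple (V : lmodType R) (w : V) : Prop :=
  [/\ flenT V, w <> 0, forall a, m a -> a *: w = 0 &
    forall S : V -> Prop, submod S -> (exists2 x, S x & x <> 0) -> S w].

(** This says m^i v = 0 without forming the ideal m^i. *)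
Fixpoint ann_pow (V : lmodType R) (i : nat) (v : V) : Prop :=
  if i is i'.+1 then forall a, m a -> ann_pow i' (a *: v) else v = 0.

Section Bound.
Variables (V : lmodType R) (w : V).
Hypothesis wV : essential_simple w.

Lemma submod_ann_pow i : submod (@ann_pow V i).
Proof.
elim: i => [|i IH]; first exact: submod_eq0.
split=> [a _|b x y Ax Ay a ma] /=; first by rewrite scaler0; apply: submod0.
rewrite scalerDr scalerA mulrC -scalerA; apply: (submodD IH); last exact: Ay.
by apply: (submodZ IH); apply: Ax.
Qed.

Lemma ann_powS i (v : V) : ann_pow i v -> ann_pow i.+1 v.
Proof.
elim: i v => [|i IH] v Av a ma; first by rewrite [v]Av scaler0.
exact/IH/Av.
Qed.

(** A non-zero kernel of c would contain w, on which c is invertible. *)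
Lemma ess_inj (c : R) (v : V) : ~ m c -> c *: v = 0 -> v = 0.
Proof.
have [_ w0 mw ess] := wV; move=> mc cv; apply: contrapT => v0; apply: w0.
have sK : submod (fun x : V => c *: x = 0).
  split=> [|a x y cx cy]; first by rewrite scaler0.
  by rewrite scalerDr scalerA mulrC -scalerA cx cy scaler0 addr0.
have cw : c *: w = 0 by apply: (ess _ sK); exists v.
by have [b ->] := max_ideal_fixed mm mc mw; rewrite cw scaler0.
Qed.

(** Let T = ann(m^s) be maximal and u an element outside T of a minimal submodule not inside T. If m
    u lies in T, then u is in ann(m^(s+1)) = T. Otherwise u = c u with c in m, and 1 - c acts
    injectively. *)
Lemma ann_pow_exhaust : exists s, forall v : V, ann_pow s v.
Proof.
have [fV _ _ _] := wV.
have [|T [sT [s Ts] _ maxT]] := @flen_max R V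
  (fun T => exists s, forall v, T v <-> ann_pow s v) _ fV (submod_eq0 V).
  by exists 0%N.
exists s => v; apply/Ts; apply: contrapT => Tv.
have [|U [sU [u Uu Tu] _ minU]] := @flen_min R V
  (fun U => exists2 u, U u & ~ T u) _ (flen_all _ fV) (submodT V).
  by exists v.
have [mu|/existsNP[r /not_implyP[mr Tru]]] := pselect (forall r, m r -> T (r *: u)).
  apply: Tu; apply: (maxT _ (submod_ann_pow s.+1)).
  - by exists s.+1.
  - by move=> x /Ts /ann_powS.
  - by move=> a /mu /Ts.
have [sm m1 _] := mm.
have sI : submod (fun x => exists2 r, m r & x = r *: u).
  split; first by exists 0; [exact: submod0|rewrite scale0r].
  move=> a _ _ [b mb ->] [c mc ->]; exists (a * b + c).
    by case: sm => _ /(_ a b c mb mc).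
  by rewrite scalerDl scalerA.
have [||c mc uE] := minU _ sI _ _ u Uu.
- by exists (r *: u) => //; exists r.
- by move=> _ [b mb ->]; apply: submodZ.
apply: Tu; rewrite (_ : u = 0); first exact: submod0.
apply: (ess_inj (c := 1 - c)); last by rewrite scalerBl scale1r -uE subrr.
by move=> m1c; apply: m1; rewrite -(subrK c 1); apply: (submodD sm).
Qed.

(** The ideals J i = ann(m^i v) ascend, are constant after the first repetition and eventually equal
    R by [ann_pow_exhaust]. So they grow strictly until they reach R, which bounds the exponent by
    the length of R independently of V. *)
Lemma ann_pow_bound n (v : V) : ~ chain n (fun _ : R^o => True) -> ann_pow n v.
Proof.
move=> nR; apply: contrapT => Anv; apply: nR.
pose J i (r : R^o) := ann_pow i (r *: v).
have sJ i : submod (J i) by apply: submod_colon; apply: submod_ann_pow.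
suff claim i : ann_pow i v \/ chain i (J i).
  by have [//|] := claim n; apply: chain_sub.
elim: i => [|i [Av|cJ]]; [by right|by left; apply: ann_powS|].
have [Jst|/existsNP[r /not_implyP[Jr nJr]]] := pselect (forall r, J i.+1 r -> J i r); last first.
  right; exists (J i); split=> //; last by exists r.
  by move=> x; apply: ann_powS.
left; apply: ann_powS.
have st k r : J (k + i)%N r -> J i r.
  elim: k r => // k IH r Jr; apply: Jst => a ma.
  by rewrite scalerA; apply: IH; rewrite /J -scalerA; apply: Jr.
have [s sV] := ann_pow_exhaust.
rewrite -[v]scale1r; apply: (st s); rewrite /J scale1r.
by elim: i {cJ Jst st sJ J} => [|i IH]; rewrite ?addn0// addnS; apply: ann_powS.
Qed.

(** ann(m) is the simple module R w: if x in it is non-zero, then w = r x with r outside m, whence x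
    is a multiple of w. *)
Lemma ann_pow1_chain : ~ chain 2 (@ann_pow V 1).
Proof.
have [_ w0 mw ess] := wV.
move=> [T [sT TA [x Ax Tx] [U [sU UT [y Ty Uy] _]]]].
have Tw : T w.
  by apply: ess => //; exists y => // y0; apply: Uy; rewrite y0; apply: submod0.
apply: Tx; have [->|/eqP x0] := eqVneq x 0; first exact: submod0.
have [r wE] : exists r, w = r *: x.
  apply: (ess _ (submod_cyclic x)); exists x => //; by exists 1; rewrite scale1r.
have mr : ~ m r by move=> /Ax rx; apply: w0; rewrite wE rx.
by have [b ->] := max_ideal_fixed mm mr Ax; rewrite -wE; apply: submodZ.
Qed.

End Bound.

(* With a_1, .., a_p generating m, the map v |-> (a_i v)_i embeds
   ann(m^(i+1)) / ann(m) in p copies of ann(m^i), and V = ann(m^n) for n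
   exceeding the length of R. *)
Lemma essential_simple_bound : exists N, forall (V : lmodType R) (w : V),
  essential_simple w -> ~ chain N (fun _ : V => True).
Proof.
have [sm _ _] := mm; have [p [a [am agen]]] := flen_gen fR sm.
have [n nR] := fR.
suff [N NP] : exists N, forall (V : lmodType R) (w : V),
    essential_simple w -> ~ chain N (@ann_pow V n).
  exists N => V w wV cV; apply: (NP V w wV); apply: chain_sub cV => v _.
  exact: (ann_pow_bound wV).
elim: n {nR} => [|n [N NP]].
  exists 1%N => V w _ [T [sT _ [x -> T0] _]].
  by apply: T0; apply: submod0.
(* The 2 is the bound for ann(m) from [ann_pow1_chain], and each of the p generators of m
   contributes N. *)
exists (2 + p * N)%N => V w wV.
have aL i : linear (fun v : V => a i *: v).
  by move=> r x y; rewrite scalerDr !scalerA mulrC.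
apply: (chain_joint (f := fun i => mklin (aL i)) (T := @ann_pow V n)).
- exact: submod_ann_pow.
- by move=> i x; apply.
- move=> c2; apply: (ann_pow1_chain wV); apply: chain_sub c2 => x [_ ax] r mr.
  have [c ->] := agen r mr; rewrite scaler_suml big1// => i _.
  by rewrite -scalerA [X in _ *: X](ax i) scaler0.
- exact: NP wV.
Qed.

Lemma max_essential_simple : exists (V : lmodType R) (w : V) n,
  [/\ essential_simple w, chain n (fun _ : V => True) &
    forall (V' : lmodType R) (w' : V'), essential_simple w' ->
      ~ chain n.+1 (fun _ : V' => True)].
Proof.
have [N NP] := essential_simple_bound; have [sm m1 _] := mm.
apply: contrapT => nmax.
suff claim n : exists (V : lmodType R) (w : V),
    essential_simple w /\ chain n (fun _ : V => True).
  by have [V [w [wV /(NP V w wV)]]] := claim N.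
elim: n => [|n [V [w [wV cV]]]].
  exists (quotmod sm), (quot_proj sm (1 : R^o)); split=> //; split.
  - by apply: flen_preim fR; exact: quot_proj_surj.
  - by move/quot_proj_eq0.
  - move=> a ma; rewrite -linearZ; apply/quot_proj_eq0.
    by rewrite -[_ *: _]/(a * 1) mulr1.
  - move=> S sS [x Sx x0]; have [r rE] := quot_proj_surj x.
    have mr : ~ m r by move/(quot_proj_eq0 sm); rewrite rE.
    have [b mb] := max_ideal_inv mm mr.
    rewrite (_ : quot_proj sm 1 = b *: x); first exact: submodZ.
    apply/subr0_eq; rewrite -rE -linearZ -linearB; exact/quot_proj_eq0.
apply: contrapT => nV; apply: nmax; exists V, w, n; split=> // V' w' wV' cV'.
by apply: nV; exists V', w'.
Qed.

(* A partial map G from W to V extends to a maximal one N; then V embeds in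
   (W x V) / N as an essential submodule, hence onto by maximality of V. *)
Lemma local_injective_cogenerator : exists I : lmodType R,
  [/\ flenT I, graph_injective I & exists2 w : I, w <> 0 & forall a, m a -> a *: w = 0].
Proof.
have [V [w [n [wV cV maxV]]]] := max_essential_simple.
have [fV w0 mw ess] := wV.
exists V; split=> //; last by exists w.
move=> W fW G sG G0.
have [N [sN N0 GN maxN]] := flen_max (P := fun N => forall v, N (0, v) -> v = 0)
  (flen_prod fW fV) sG G0.
have jL : linear (fun v : V => (0 : W, v)).
  by move=> a x y; apply: injective_projections; rewrite //= scaler0 addr0.
pose j : {linear V -> quotmod sN} := quot_proj sN \o mklin jL.
have jI : injective j.
  move=> x y xy; apply/subr0_eq/N0; apply/(quot_proj_eq0 sN).
  by rewrite -[LHS]/(j (x - y)) linearB xy subrr.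
(* A submodule of the quotient meeting the image of V only in 0 pulls back to a partial map
   extending N, which is N itself by maximality. *)
have jw : essential_simple (j w).
  split.
  - by apply: (flen_preim (f := quot_proj sN)); [exact: quot_proj_surj|exact: flen_prod].
  - by rewrite -(linear0 j) => /jI.
  - by move=> a ma; rewrite -linearZ mw// linear0.
  - move=> S sS [x Sx x0].
    suff [v Sv v0] : exists2 v, S (j v) & v <> 0.
      by apply: (ess _ (submod_preim j sS)); exists v.
    apply: contrapT => nv; apply: x0; have [p pE] := quot_proj_surj x.
    rewrite -pE; apply/quot_proj_eq0.
    apply: (maxN _ (submod_preim (quot_proj sN) sS)).
    + move=> v Sv; apply: contrapT => v0; apply: nv; by exists v.
    + by move=> q Nq; rewrite (quot_proj_eq0 sN q).2//; apply: submod0.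
    + by rewrite pE.
have jS x : exists v, j v = x.
  apply: contrapT => /forallNP nx; apply: (maxV _ _ jw).
  exists (fun y => exists2 v, True & y = j v); split=> //.
  - exact: submod_image.
  - by exists x => // -[v _ /esym/nx].
  - exact: (chain_image jI cV).
have NU x v v' : N (x, v) -> N (x, v') -> v = v'.
  move=> Nv Nv'; apply/subr0_eq/N0; have := submodB sN Nv Nv'.
  by congr N; apply: injective_projections; rewrite /= ?subrr.
have /choice[phi phiP] x : exists v, N (x, v).
  (* (x, 0) and (0, v) have the same class, so (x, -v) lies in N. *)
  have [v vE] := jS (quot_proj sN (x, 0)); exists (- v).
  apply/(quot_proj_eq0 sN); rewrite (_ : (x, - v) = (x, 0) - mklin jL v).
    by rewrite linearB -vE subrr.
  by apply: injective_projections; rewrite /= ?subr0 ?sub0r.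
have phiL : linear phi.
  move=> a x y; apply: (NU _ _ _ (phiP _)).
  by have [_ /(_ a _ _ (phiP x) (phiP y))] := sN.
by exists (mklin phiL) => x v /GN /(NU _ _ _ (phiP x)).
Qed.

End EssentialExtensions.

Section Cogenerator.
Variable R : comNzRingType.
Hypothesis fR : flenT (R^o : lmodType R).

Lemma graph_injective_prod (I J : lmodType R) :
  graph_injective I -> graph_injective J -> graph_injective (I * J)%type.
Proof.
move=> Iinj Jinj W fW G sG G0.
have [||f fP] := Iinj W fW (fun p => exists v, G (p.1, (p.2, v))).
- split; first by exists 0; apply: (submod0 sG).
  move=> a [x u] [x' u'] [v Gv] [v' Gv']; exists (a *: v + v').
  by have [_ /(_ a _ _ Gv Gv')] := sG.
- by move=> v [u /G0 []].
have [||g gP] := Jinj W fW (fun p => exists v, G (p.1, (v, p.2))).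
- split; first by exists 0; apply: (submod0 sG).
  move=> a [x u] [x' u'] [v Gv] [v' Gv']; exists (a *: v + v').
  by have [_ /(_ a _ _ Gv Gv')] := sG.
- by move=> v [u /G0 []].
have fgL : linear (fun x => (f x, g x)).
  by move=> a x y; apply: injective_projections; rewrite /= linearP.
exists (mklin fgL) => x [u v] Gxuv; congr pair.
  by apply: fP; exists v.
by apply: gP; exists u.
Qed.

Theorem injective_cogenerator_ex : exists I : lmodType R,
  [/\ flenT I, graph_injective I & meets_simples I].
Proof.
have [n [M [MM Mall]]] := max_ideals_finite fR.
suff [I [fI Iinj IM]] : exists I : lmodType R, [/\ flenT I, graph_injective I &
    forall i, exists2 w : I, w <> 0 & forall a, M i a -> a *: w = 0].
  exists I; split=> // m /Mall[i mi]; have [w w0 mw] := IM i.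
  by exists w => // a /mi /mw.
elim: n M MM {Mall} => [|n IH] M MM.
  exists {ffun 'I_0 -> R^o}; split; [exact: flen_ffun| |by case].
  by move=> W fW G sG G0; exists \0 => w v _; apply/ffunP => -[].
have [I [fI Iinj IM]] := IH (fun i => M (lift ord0 i)) (fun i => MM _).
have [J [fJ Jinj [w w0 mw]]] := local_injective_cogenerator fR (MM ord0).
exists (J * I)%type; split; [exact: flen_prod|exact: graph_injective_prod|].
move=> i; case: (unliftP ord0 i) => [k ->|->].
  have [u u0 mu] := IM k; exists (0, u) => [[/u0]//|a ma].
  by apply: injective_projections; rewrite /= ?scaler0// mu.
exists (w, 0) => [[/w0]//|a ma].
by apply: injective_projections; rewrite /= ?scaler0// mw.
Qed.

End Cogenerator.

(** * The theorem *)

Section Main.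
Variables (R : comNzRingType) (L : algType R) (C : lmodType L -> Prop).
Hypothesis artL : artin_algebra L.
Hypothesis Cfg : subcategory_of_mod C.
Hypothesis Csum : closed_summands C.
Hypothesis Cff : functorially_finite C.

Let fR : flenT (R^o : lmodType R).
Proof. by apply: artinian_flen; case: artL. Qed.

Let gL : fin_gen (L^o : lmodType L).
Proof.
exists 1%N, (fun=> 1) => x; exists (fun=> x).
by rewrite big_ord1 -[_ *: _]/(x * 1) mulr1.
Qed.

Let Cex : exists X, C X.
Proof. by have [[Y [f [CY _]]] _] := Cff gL; exists Y. Qed.

(** A section of p f would give one of p, so the composite with the approximation f stays radical,
    and factorisations lift along f. *)
Lemma right_almost_split_approx : right_almost_split C.
Proof.
move=> X [CX iX]; have [I [fI Iinj Isim]] := injective_cogenerator_ex fR.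
have [E [p [gE nsp pP]]] := right_almost_split_mod artL Iinj fI Isim iX (Cfg CX).
have [_ [Z [f [CZ fP]]]] := Cff gE.
exists Z, (p \o f : {linear Z -> X}); split=> //.
  apply: rad_not_split_epi => //; first exact: (C_flen artL Cfg CX).
  by move=> [s ps]; apply: nsp; exists (f \o s : {linear X -> E}).
move=> Y h CY rh; have [k ->] := pP Y h (Cfg CY) rh.
have [k' kE] := fP Y k CY; exists k'.
by apply: linear_eq => y; rewrite /= kE.
Qed.

Lemma left_almost_split_approx (I : lmodType R) : graph_injective I ->
  socle_multiplicity_one I -> flenT (restr (dual L I)) -> left_almost_split C.
Proof.
move=> Iinj Isoc fD X [CX iX].
have [E [q [gE nsp qP]]] := left_almost_split_mod artL Iinj Isoc fD iX (Cfg CX).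
have [[Z [f [CZ fP]]] _] := Cff gE.
exists Z, (f \o q : {linear X -> Z}); split=> //.
  apply: rad_not_split_mono => //; first exact: (C_flen artL Cfg CX).
  by move=> [r rq]; apply: nsp; exists (r \o f : {linear E -> X}).
move=> Y h CY rh; have [k ->] := qP Y h (Cfg CY) rh.
have [k' kE] := fP Y k CY; exists k'.
by apply: linear_eq => y; rewrite /= kE.
Qed.

Lemma hits_from_cogenerator : exists2 W, C W &
  forall Y, ind C Y -> exists f : {linear Y -> W}, ~ f =1 \0.
Proof.
have [I [fI Iinj Isim]] := injective_cogenerator_ex fR.
have gD : fin_gen (dual L I) by apply/flen_restr_fin_gen/flen_dual => //; case: artL.
have [_ [W [f [CW fP]]]] := Cff gD; exists W => // Y [CY [/existsNP[y y0] _]].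
have [eta ey] := separate0 fR Iinj Isim (W := restr Y) (C_flen_restr artL Cfg CY) y0.
have [k kE] := fP Y (dual_map eta) CY; exists k => k0.
by apply: (dual_map_neq0 ey); rewrite kE /= k0 linear0.
Qed.

Lemma hits_from_regular : exists2 W, C W &
  forall Y, ind C Y -> exists f : {linear W -> Y}, ~ f =1 \0.
Proof.
have [[W [f [CW fP]]] _] := Cff gL; exists W => // Y [CY [/existsNP[y y0] _]].
have yL : linear (fun a : L^o => a *: y) by move=> a b c; rewrite scalerDl scalerA.
have [k kE] := fP Y (mklin yL) CY; exists k => k0; apply: y0.
by have := kE 1; rewrite /= scale1r k0.
Qed.

End Main.

Theorem theoremA (R : comNzRingType) (L : algType R) (C : lmodType L -> Prop) :
  artin_algebra L ->
  subcategory_of_mod C ->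
  additive_subcategory C ->
  closed_summands C ->
  closed_iso C ->
  functorially_finite C ->
  (forall (I : lmodType R) (e : {linear residue_ring R -> I}),
    injective_envelope e -> C (dual L I) ->
    [<-> (exists2 t : nat, (1 <= t)%N & forall X, ind C X -> rad_pow_from_zero C t X);
         (forall X, ind C X -> exists2 t : nat, (1 <= t)%N & rad_pow_from_zero C t X);
         finite_rep_type C;
         rad_infty_zero C]) /\
  (C L^o ->
    [<-> (exists2 t : nat, (1 <= t)%N & forall X, ind C X -> rad_pow_to_zero C t X);
         (forall X, ind C X -> exists2 t : nat, (1 <= t)%N & rad_pow_to_zero C t X);
         finite_rep_type C;
         rad_infty_zero C]).
Proof.
move=> artL Cfg Cadd Csum _ Cff.
have fR : flenT (R^o : lmodType R) by apply: artinian_flen; case: artL.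
have Cex : exists X, C X by have [W CW _] := hits_from_regular Cff; exists W.
have nilp := finite_type_rad_nilpotent artL Cfg Cadd Csum Cex.
have nilp_infty : finite_rep_type C -> rad_infty_zero C.
  move=> /nilp[t t1 tP] X Y f CX CY fr; apply: tP => //; exact: fr.
split=> [I e envI CD|CL].
  have Iinj := injective_graph_injective envI.1.
  have Isoc := envelope_socle fR envI.
  have Isim := submod_socle_mult_simples Isoc.
  (* D L has finite length over R because it lies in C. *)
  have las := left_almost_split_approx artL Cfg Cff Iinj Isoc (C_flen_restr artL Cfg CD).
  have [W CW WP] := hits_from_regular Cff.
  have ii_iii := finite_of_rad_pow_from_zero artL Cfg Csum las CW WP.
  have cog (Y : lmodType L) (y : Y) : C Y -> y <> 0 -> exists g : {linear Y -> dual L I}, g y <> 0.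
    move=> CY y0.
    have [eta ey] := separate0 fR Iinj Isim (W := restr Y) (C_flen_restr artL Cfg CY) y0.
    by exists (dual_map eta); exact: dual_map_neq0.
  tfae=> [[t t1 tP] X iX|//|//|r0]; first by exists t => //; exact: tP.
  (* From (iv) one gets (ii), hence (iii); the uniform exponent of (i) then comes from the
     nilpotency of the radical. *)
  have [|t t1 tP] := nilp.
    apply: ii_iii => X [CX iX].
    exact: (rad_pow_from_zero_of_infty artL Cfg CD cog CX r0).
  by exists t => // X [CX iX] Y f CY; exact: tP.
have ras := right_almost_split_approx artL Cfg Cff.
have [W CW WP] := hits_from_cogenerator artL Cfg Cff.
have ii_iii := finite_of_rad_pow_to_zero artL Cfg Csum ras CW WP.
tfae=> [[t t1 tP] X iX|//|//|r0]; first by exists t => //; exact: tP.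
have [|t t1 tP] := nilp.
  apply: ii_iii => X [CX iX].
  exact: (rad_pow_to_zero_of_infty artL Cfg CL CX r0).
by exists t => // X [CX iX] Y f CY; exact: tP.
Qed.
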